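(* For each positive integer $n \geq 1$ there is a field $F$ of characteristic $\neq 2$ with $m(F) = 2n$.
   Context: All quadratic forms are non-degenerate. A quadratic form over a field $k$ is universal if it represents every element of $k^{\times}$. The $m$-invariant $m(k)$ of a field $k$ of characteristic $\neq 2$ is the minimal dimension of an anisotropic universal quadratic form over $k$. *)

(* Defs.v *)
From mathcomp Require Import all_boot all_algebra.

Set Implicit Arguments.
Unset Strict Implicit.
Unset Printing Implicit Defensive.

Import GRing.Theory.
Local Open Scope ring_scope.

Section QuadraticForms.
Variables (F : fieldType) (V : vectType F).
Implicit Type q : V -> F.

(* No factor 1/2: in characteristic different from 2, which is the only case
   of interest here, this is twice the symmetric bilinear form b with
   q v = b v v, and has the same radical. *)
Definition polar q (u v : V) : F := q (u + v) - q u - q v.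

Definition quadratic_form q : Prop :=
  [/\ forall (a : F) (v : V), q (a *: v) = a ^+ 2 * q v,
      forall v : V, scalar (fun u => polar q u v)
    & forall u : V, scalar (polar q u)].

Definition quad_nondegenerate q : Prop :=
  forall u : V, (forall v : V, polar q u v = 0) -> u = 0.

Definition anisotropic q : Prop := forall v : V, q v = 0 -> v = 0.

Definition universal q : Prop :=
  forall a : F, a != 0 -> exists v : V, q v = a.

Definition anisotropic_universal_form q : Prop :=
  [/\ quadratic_form q, quad_nondegenerate q, anisotropic q & universal q].

End QuadraticForms.

(* "m(F) = m", for F of characteristic different from 2. It holds for no
   natural number m when F has no anisotropic universal form (m(F) infinite). *)
Definition m_invariant_eq (F : fieldType) (m : nat) : Prop :=
  (exists (V : vectType F) (q : V -> F),
      anisotropic_universal_form q /\ \dim {:V} = m)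
  /\ (forall (V : vectType F) (q : V -> F),
      anisotropic_universal_form q -> (m <= \dim {:V})%N).

(* Main.v *)
(* Let q be a form of dimension 2n whose even Clifford algebra D is a division
   algebra, of dimension 2^(2n-1) over the base field; such forms exist with
   generic coefficients. By Merkurjev and Tignol, a division algebra A acquires
   zero divisors over the function field F(rho) of a quadric only if the even
   Clifford algebra of rho maps to A; this is proved by conjugating a square
   root, in A(t), of a polynomial into A[t], the right ideals of which are
   principal.

   The field is the union of a tower along which D stays division, so that q
   stays anisotropic. Let rho be a form over a field F of the tower.
   - If rho = q + <-a>, or if rho is isotropic over F(q) and dim rho < 2n, pass
     to F(rho). If D acquired zero divisors, the even Clifford algebra of rho
     would map to D. In the first case it is too large for that. In the second
     case its image A is division of dimension less than dim D, so A stays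
     division over F(q), and therefore rho is anisotropic over F(q).
   - If rho is anisotropic over F(q) and dim rho < 2n, adjoin a transcendental
     t. Then rho + <-t> is anisotropic over F(t)(q), and it remains so later:
     all forms whose function fields are adjoined are isotropic over the
     function field of q, so these extensions become purely transcendental
     there.
   In the limit q is universal and anisotropic, and no anisotropic form of
   smaller dimension is universal. *)

Require Import Defs.
From HB Require Import structures.
From mathcomp Require Import all_boot all_algebra.
From mathcomp Require Import boolp zify ring reals Rstruct complex.
From mathcomp Require classical_sets functions cardinality.
From Stdlib Require Runcountable.

Set Implicit Arguments.
Unset Strict Implicit.
Unset Printing Implicit Defensive.

Import GRing.Theory Num.Theory.
Local Open Scope ring_scope.

(** The parity of the dimension enters through a count of generators. With [r = 2n - 1], the algebra
    [D] has [r] anticommuting generators, and a form of dimension at least [r + 2] yields at least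
    [r + 1] of them, where [r + 1] is even. The monomials of an even number of anticommuting
    elements with nonzero squares are always independent, so [r + 1] of them do not fit into
    dimension [2 ^ r]. For an odd number, the product of all of them commutes with each one and may
    coincide with a scalar, and this count breaks down.

    Function fields are not built abstractly. A countable subfield of the complex numbers leaves
    room for transcendental elements, and all square roots are at hand, so a function field is a
    purely transcendental extension followed by a square root. [D] lives in a matrix ring over the
    complex numbers, as the span of a family that is independent over them; along the tower this
    family is fixed, and extension of scalars only enlarges its coefficients. *)

(** * Division subrings and quadratic extensions *)

(* All fields of the construction are subfields of one field [K] (in the end the
   complex numbers) and are encoded as predicates on it; likewise an algebra
   over a subfield is a predicate on a ring [R] with a central map from [K]. *)
Definition subfield (K : fieldType) (F : K -> Prop) :=
  [/\ F 1, forall x y, F x -> F y -> F (x - y),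
      forall x y, F x -> F y -> F (x * y) & forall x, F x -> F x^-1].

Definition subring (R : nzRingType) (B : R -> Prop) :=
  [/\ B 1, forall x y, B x -> B y -> B (x - y)
    & forall x y, B x -> B y -> B (x * y)].

(** Left inverses only; [division_inverse] makes them two-sided. *)
Definition division (R : nzRingType) (B : R -> Prop) :=
  forall x, B x -> x != 0 -> exists2 y, B y & y * x = 1.

Definition poly_in (R : nzRingType) (B : R -> Prop) (p : {poly R}) :=
  forall i, B p`_i.

Definition transcendental (K : fieldType) (F : K -> Prop) (t : K) :=
  forall p, poly_in F p -> p.[t] = 0 -> p = 0.

Definition quad_ext (R : nzRingType) (B : R -> Prop) (u x : R) :=
  exists y z, [/\ B y, B z & x = y + z * u].

Section Subrings.
Variables (R : nzRingType) (B : R -> Prop).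
Hypothesis sB : subring B.

Lemma subring1 : B 1. Proof. by case: sB. Qed.
Lemma subringB x y : B x -> B y -> B (x - y). Proof. by case: sB => _ + _; apply. Qed.
Lemma subringM x y : B x -> B y -> B (x * y). Proof. by case: sB => _ _; apply. Qed.
Lemma subring0 : B 0. Proof. by rewrite -(subrr 1); apply: subringB subring1 subring1. Qed.
Lemma subringN x : B x -> B (- x).
Proof. by move=> Bx; rewrite -sub0r; apply: subringB subring0 Bx. Qed.
Lemma subringD x y : B x -> B y -> B (x + y).
Proof. by move=> Bx By; rewrite -[y]opprK; apply/subringB/subringN. Qed.
Lemma subringX x n : B x -> B (x ^+ n).
Proof. by move=> Bx; elim: n => [|n IH]; [exact: subring1|rewrite exprS; apply: subringM]. Qed.
Lemma subring_sum I (r : seq I) (P : pred I) (F : I -> R) :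
  (forall i, P i -> B (F i)) -> B (\sum_(i <- r | P i) F i).
Proof. by move=> H; apply: big_ind => //; [exact: subring0|exact: subringD]. Qed.
Lemma subring_prod I (r : seq I) (P : pred I) (F : I -> R) :
  (forall i, P i -> B (F i)) -> B (\prod_(i <- r | P i) F i).
Proof. by move=> H; apply: big_ind => //; [exact: subring1|exact: subringM]. Qed.

Lemma poly_in_subring : subring (poly_in B).
Proof.
split=> [i|p q Hp Hq i|p q Hp Hq i].
- by rewrite coef1; case: eqP => _; [exact: subring1|exact: subring0].
- by rewrite coefB; apply: subringB.
- by rewrite coefM; apply: subring_sum => j _; apply: subringM.
Qed.

Lemma poly_inC c : B c -> poly_in B c%:P.
Proof. by move=> Bc i; rewrite coefC; case: eqP => // _; exact: subring0. Qed.

Lemma poly_inX : poly_in B 'X.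
Proof. by move=> i; rewrite coefX; case: eqP => _; [exact: subring1|exact: subring0]. Qed.

Lemma poly_in_horner p a : poly_in B p -> B a -> B p.[a].
Proof.
move=> Bp Ba; rewrite horner_coef; apply: subring_sum => i _.
by apply: subringM => //; apply: subringX.
Qed.

Hypothesis dB : division B.

Lemma division_regular x y : B x -> x != 0 -> x * y = 0 -> y = 0.
Proof.
move=> Bx nx xy; have [z _ zx] := dB Bx nx.
by rewrite -[y]mul1r -zx -mulrA xy mulr0.
Qed.

Lemma division_inverse x : B x -> x != 0 -> exists y, [/\ B y, y * x = 1 & x * y = 1].
Proof.
move=> Bx nx; have [y By yx] := dB Bx nx.
have ny : y != 0 by apply: contra_eq_neq yx => ->; rewrite mul0r eq_sym oner_neq0.
have [z Bz zy] := dB By ny; exists y; split=> //.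
by rewrite -{1}[x]mul1r -zy -(mulrA z y x) yx mulr1.
Qed.

End Subrings.

Lemma subfield_subring (K : fieldType) (F : K -> Prop) : subfield F -> subring F.
Proof. by case. Qed.

Lemma subfieldV (K : fieldType) (F : K -> Prop) x : subfield F -> F x -> F x^-1.
Proof. by case=> _ _ _; apply. Qed.

Lemma subfield_division (K : fieldType) (F : K -> Prop) : subfield F -> division F.
Proof. by move=> sF x Fx nx; exists x^-1; [apply: subfieldV|rewrite mulVf]. Qed.

(* Multiplying [u + x] on the left by [u - sigma x] gives [u^2 - sigma x * x],
   which lies in [B]. *)
Lemma quad_ext_division (R : nzRingType) (B : R -> Prop) (u : R) (sigma : R -> R) :
  subring B -> division B -> B (u * u) ->
  (forall y, B y -> B (sigma y) /\ u * y = sigma y * u) ->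
  (forall x, B x -> sigma x * x != u * u) ->
  subring (quad_ext B u) /\ division (quad_ext B u).
Proof.
move=> sB dB Bu Hs Hn.
have inB x : B x -> quad_ext B u x.
  by move=> Bx; exists x, 0; split=> //; [exact: subring0|rewrite mul0r addr0].
have sQ : subring (quad_ext B u).
  split.
  - by apply: inB; apply: subring1.
  - move=> _ _ [y [z [By Bz ->]]] [y' [z' [By' Bz' ->]]].
    exists (y - y'), (z - z'); split; [exact: subringB|exact: subringB|].
    by rewrite mulrBl opprD addrACA.
  - move=> _ _ [y [z [By Bz ->]]] [y' [z' [By' Bz' ->]]].
    have [By2 Ey2] := Hs _ By'; have [Bz2 Ez2] := Hs _ Bz'.
    exists (y * y' + z * sigma z' * (u * u)), (y * z' + z * sigma y'); split.
    + apply: (subringD sB); first exact: subringM.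
      by apply: (subringM sB) => //; apply: subringM.
    + by apply: (subringD sB); apply: subringM.
    + rewrite mulrDl !mulrDr mulrDl -!mulrA Ey2 (mulrA u z') Ez2.
      by rewrite !mulrA [in RHS]addrAC !addrA.
split=> // _ [y [z [By Bz ->]]] nx.
have [z0|nz] := eqVneq z 0.
  move: nx; rewrite z0 mul0r addr0 => ny.
  by have [w Bw wy] := dB _ By ny; exists w => //; apply: inB.
have [w [Bw wz zw]] := division_inverse dB Bz nz.
set x := w * y; have Bx : B x by apply: subringM.
have [Bsx Esx] := Hs _ Bx.
have nc : u * u - sigma x * x != 0 by rewrite subr_eq0 eq_sym; apply: Hn.
have Bc : B (u * u - sigma x * x) by apply: (subringB sB) => //; apply: (subringM sB).
have [v Bv vc] := dB _ Bc nc.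
exists (v * ((- sigma x + 1 * u) * w)).
  apply: (subringM sQ); first exact: inB.
  apply: (subringM sQ); last exact: inB.
  by exists (- sigma x), 1; split=> //; [apply: subringN|apply: subring1].
have E : w * (y + z * u) = x + u by rewrite mulrDr mulrA wz mul1r.
rewrite -!mulrA E mul1r -[RHS]vc; congr (_ * _).
by rewrite mulrDl !mulrDr Esx !mulNr addrA subrK addrC.
Qed.

(** If [s * s] is already a square in [F], then [s] is in [F] and the extension is [F] itself;
    otherwise [quad_ext_division] applies with the trivial automorphism. *)
Lemma quad_ext_subfield (K : fieldType) (F : K -> Prop) (s : K) :
  subfield F -> F (s * s) -> subfield (quad_ext F s).
Proof.
move=> sF Fs; have rF := subfield_subring sF.
have [[x Fx xs]|Hn] := pselect (exists2 x, F x & x * x = s * s).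
  have Fs1 : F s.
    have : (x - s) * (x + s) = 0 by rewrite -subr_sqr !expr2 xs subrr.
    move/eqP; rewrite mulf_eq0 subr_eq0 addr_eq0 => /orP[/eqP <- //|/eqP E].
    by rewrite -[s]opprK -E; apply: subringN.
  suff E z : quad_ext F s z <-> F z.
    split=> [|a b /E Fa /E Fb|a b /E Fa /E Fb|a /E Fa]; apply/E.
    - exact: subring1.
    - exact: subringB.
    - exact: subringM.
    - exact: subfieldV.
  split=> [[a [b [Fa Fb ->]]]|Fz]; first by apply: (subringD rF) => //; apply: subringM.
  by exists z, 0; split=> //; [exact: subring0|rewrite mul0r addr0].
have [||[? ? ?] dQ] := @quad_ext_division K F s id rF (subfield_division sF) Fs.
- by move=> y Fy; split=> //; rewrite mulrC.
- by move=> x Fx; apply/negP => /eqP E; apply: Hn; exists x.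
split=> // x Qx; have [->|nx] := eqVneq x 0.
  by rewrite invr0 -(subrr 1) ; apply: subringB.
by have [y Qy yx] := dQ _ Qx nx; rewrite -[x^-1]mul1r -yx mulfK.
Qed.

(** * Adjoining an element *)

Section Adjunction.
Variables (K : fieldType) (R : nzRingType) (io : {rmorphism K -> R}).
Hypothesis ioC : forall a x, io a * x = x * io a.

Definition scalar_closed (F : K -> Prop) (B : R -> Prop) :=
  forall a, F a -> B (io a).

(** The tensor product of [B] with [F(t)], for [t] transcendental. Denominators come from [F[t]],
    whose image is central, so fractions are added and multiplied as in the commutative case. *)
Definition adjoin (F : K -> Prop) (B : R -> Prop) (t : K) (x : R) :=
  exists P b, [/\ poly_in B P, poly_in F b, b.[t] != 0
                & x = io b.[t]^-1 * P.[io t]].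

Lemma central_horner t (P : {poly R}) : comm_poly P (io t).
Proof.
rewrite /comm_poly horner_coef mulr_suml mulr_sumr; apply: eq_bigr => i _.
by rewrite ioC.
Qed.

Lemma central_hornerM t (P Q : {poly R}) :
  (P * Q).[io t] = P.[io t] * Q.[io t].
Proof. by apply: hornerM_comm; apply: central_horner. Qed.

Lemma ioV a : a != 0 -> io a * io a^-1 = 1.
Proof. by move=> na; rewrite -rmorphM mulfV // rmorph1. Qed.

Lemma ioVl a : a != 0 -> io a^-1 * io a = 1.
Proof. by move=> na; rewrite -rmorphM mulVf // rmorph1. Qed.

Lemma io_regular a x : a != 0 -> io a * x = 0 -> x = 0.
Proof. by move=> na E; rewrite -[x]mul1r -(ioVl na) -mulrA E mulr0. Qed.

Variables (F : K -> Prop) (B : R -> Prop) (t : K).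
Hypotheses (sF : subfield F) (sB : subring B) (FB : scalar_closed F B).
Let rF := subfield_subring sF.

Lemma poly_in_map p : poly_in F p -> poly_in B (map_poly io p).
Proof. by move=> Fp i; rewrite coef_map; apply: FB. Qed.

Lemma adjoin_horner P : poly_in B P -> adjoin F B t P.[io t].
Proof.
move=> BP; exists P, 1; rewrite hornerE oner_neq0 invr1 rmorph1 mul1r; split=> //.
exact: (subring1 (poly_in_subring rF)).
Qed.

Lemma adjoin_base x : B x -> adjoin F B t x.
Proof. by move=> Bx; have := adjoin_horner (poly_inC sB Bx); rewrite hornerC. Qed.

Lemma adjoin_gen : adjoin F B t (io t).
Proof. by have := adjoin_horner (poly_inX sB); rewrite hornerX. Qed.

Lemma adjoin_subring : subring (adjoin F B t).
Proof.
have pB := poly_in_subring sB; have pF := poly_in_subring rF.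
split.
- exact: adjoin_base (subring1 sB).
- move=> _ _ [P [b [BP Fb nb ->]]] [Q [c [BQ Fc nc ->]]].
  exists (map_poly io c * P - map_poly io b * Q), (b * c).
  rewrite hornerM mulf_neq0 //; split=> //.
  + by apply: (subringB pB); apply: (subringM pB) => //; apply: poly_in_map.
  + exact: (subringM pF).
  + rewrite hornerD hornerN !central_hornerM !horner_map /= mulrBr invfM rmorphM !mulrA.
    congr (_ * _ - _ * _); first by rewrite -mulrA ioVl // mulr1.
    by rewrite -!rmorphM -mulrA [_^-1 * b.[t]]mulrC mulrA mulVf // mul1r.
- move=> _ _ [P [b [BP Fb nb ->]]] [Q [c [BQ Fc nc ->]]].
  exists (P * Q), (b * c); rewrite hornerM mulf_neq0 //; split=> //.
  + exact: (subringM pB).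
  + exact: (subringM pF).
  + by rewrite central_hornerM invfM rmorphM -!mulrA; congr (_ * _); rewrite !mulrA -ioC.
Qed.

End Adjunction.

Definition adjoin_field (K : fieldType) (F : K -> Prop) (t : K) :=
  adjoin (idfun : {rmorphism K -> K}) F F t.

Section FieldAdjunction.
Variables (K : fieldType) (F : K -> Prop) (t : K).
Hypothesis sF : subfield F.
Let rF := subfield_subring sF.

Lemma adjoin_fieldP x :
  adjoin_field F t x <->
  exists p b, [/\ poly_in F p, poly_in F b, b.[t] != 0 & x = p.[t] / b.[t]].
Proof.
by split=> -[p [b [? ? ? ->]]]; exists p, b; split=> //; rewrite mulrC.
Qed.

Lemma adjoin_subfield : subfield (adjoin_field F t).
Proof.
have [] := @adjoin_subring K K idfun (fun a x => mulrC _ _) F F t sF rF _ => //.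
move=> *; split=> // x /adjoin_fieldP[p [b [Fp Fb nb ->]]].
apply/adjoin_fieldP; have [p0|np] := eqVneq p.[t] 0.
  exists 0, 1; rewrite !hornerE oner_neq0 p0 !mul0r invr0; split=> //.
  - exact: (subring0 (poly_in_subring rF)).
  - exact: (subring1 (poly_in_subring rF)).
by exists b, p; split=> //; rewrite invf_div.
Qed.

Lemma adjoin_field_base x : F x -> adjoin_field F t x.
Proof. by apply: adjoin_base. Qed.

Lemma adjoin_field_gen : adjoin_field F t t.
Proof. exact: (@adjoin_gen K K idfun F F t sF rF). Qed.

Lemma adjoin_scalar (R : nzRingType) (io : {rmorphism K -> R}) (B : R -> Prop) :
  scalar_closed io F B -> scalar_closed io (adjoin_field F t) (adjoin io F B t).
Proof.
move=> FB _ [p [b [Fp Fb nb ->]]].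
exists (map_poly io p), b; split=> //; first exact: (poly_in_map FB Fp).
by rewrite horner_map /= -rmorphM.
Qed.

End FieldAdjunction.

Lemma adjoin_mono (K : fieldType) (R : nzRingType) (io : {rmorphism K -> R})
    (F F' : K -> Prop) (B B' : R -> Prop) (t : K) x :
  (forall a, F a -> F' a) -> (forall y, B y -> B' y) ->
  adjoin io F B t x -> adjoin io F' B' t x.
Proof.
move=> FF BB [P [b [BP Fb nb ->]]]; exists P, b; split=> // i; [exact: BB|exact: FF].
Qed.

Lemma quad_ext_mono (R : nzRingType) (B B' : R -> Prop) (u x : R) :
  (forall y, B y -> B' y) -> quad_ext B u x -> quad_ext B' u x.
Proof. by move=> BB [y [z [By Bz ->]]]; exists y, z; split=> //; apply: BB. Qed.

Lemma quad_ext_base (R : nzRingType) (B : R -> Prop) (u x : R) :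
  subring B -> B x -> quad_ext B u x.
Proof. by move=> sB Bx; exists x, 0; rewrite mul0r addr0; split=> //; apply: subring0. Qed.

Lemma quad_ext_gen (R : nzRingType) (B : R -> Prop) (u : R) :
  subring B -> quad_ext B u u.
Proof.
by move=> sB; exists 0, 1; rewrite mul1r add0r; split=> //; [apply: subring0|apply: subring1].
Qed.

Lemma transcendental_mono (K : fieldType) (F F' : K -> Prop) t :
  (forall a, F a -> F' a) -> transcendental F' t -> transcendental F t.
Proof. by move=> FF Ht p Fp; apply: Ht => i; apply: FF. Qed.

(** * Linear algebra over a subfield *)

Section SubfieldType.
Variables (K : fieldType) (F : K -> Prop) (sF : subfield F).

(** The argument lets the closure properties be inferred from the predicate. The field type built
    from it gives access to matrix ranks over [F], and is the field of the final theorem. *)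
Definition subfield_mem of subfield F := [pred x | `[<F x>]].

Lemma subfield_divring_closed : divring_closed (subfield_mem sF).
Proof.
have rF := subfield_subring sF.
split=> [|x y /asboolP Fx /asboolP Fy|x y /asboolP Fx /asboolP Fy]; apply/asboolP.
- exact: subring1.
- exact: subringB.
- by apply: (subringM rF) => //; apply: subfieldV.
Qed.

HB.instance Definition _ :=
  GRing.isDivringClosed.Build K (subfield_mem sF) subfield_divring_closed.

Record subfield_type := SubfieldElt {
  subfield_val : K;
  subfield_valP : subfield_val \in subfield_mem sF }.

HB.instance Definition _ := [isSub for subfield_val].
HB.instance Definition _ := [Choice of subfield_type by <:].
HB.instance Definition _ := [SubChoice_isSubComUnitRing of subfield_type by <:].
HB.instance Definition _ := [SubComUnitRing_isSubIntegralDomain of subfield_type by <:].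
HB.instance Definition _ := [SubIntegralDomain_isSubField of subfield_type by <:].

End SubfieldType.


Lemma field_dependence_ord (K : fieldType) (F : K -> Prop) m n
    (A : 'I_m -> 'I_n -> K) :
  subfield F -> (n < m)%N -> (forall i j, F (A i j)) ->
  exists c : 'I_m -> K, [/\ forall i, F (c i), exists i, c i != 0
                          & forall j, \sum_i c i * A i j = 0].
Proof.
move=> sF nm FA.
have inF i j : A i j \in subfield_mem sF by apply/asboolP.
pose M := \matrix_(i, j) SubfieldElt (inF i j).
have : kermx M != 0.
  by rewrite -mxrank_eq0 mxrank_ker subn_eq0 -ltnNge (leq_ltn_trans (rank_leq_col M)).
case/matrix0Pn=> i0 [i1 nz].
exists (fun i => val (kermx M i0 i)); split.
- by move=> i; apply/asboolP/(subfield_valP (kermx M i0 i)).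
- by exists i1; apply: contraNneq nz => E; apply/eqP/val_inj.
- move=> j; have /matrixP/(_ i0 j) := mulmx_ker M.
  rewrite !mxE => /(congr1 val); rewrite rmorph_sum /= => E.
by rewrite -[RHS]E; apply: eq_bigr => i _; rewrite [M i j]mxE.
Qed.

Lemma field_dependence (K : fieldType) (F : K -> Prop) (S T : finType)
    (A : S -> T -> K) :
  subfield F -> (#|T| < #|S|)%N -> (forall i j, F (A i j)) ->
  exists c : S -> K, [/\ forall i, F (c i), exists i, c i != 0
                       & forall j, \sum_i c i * A i j = 0].
Proof.
move=> sF TS FA.
have [c [Fc [i ci] cA]] := field_dependence_ord sF TS
  (fun i j => FA (enum_val i) (enum_val j)).
exists (fun i => c (enum_rank i)); split=> [//||j].
  by exists (enum_val i); rewrite enum_valK.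
rewrite -[RHS](cA (enum_rank j)) (reindex (fun k : 'I_#|S| => enum_val k)) /=; last first.
  by apply: onW_bij; apply: enum_val_bij.
by apply: eq_bigr => k _; rewrite enum_valK enum_rankK.
Qed.

Section Span.
Variables (K : fieldType) (R : nzRingType) (io : {rmorphism K -> R}).
Hypothesis ioC : forall a x, io a * x = x * io a.

Definition span (T : finType) (F : K -> Prop) (b : T -> R) (x : R) :=
  exists2 c : T -> K, forall i, F (c i) & x = \sum_i io (c i) * b i.

(** The coefficients range over all of [K], so that one family stays independent over every
    subfield. *)
Definition independent (T : finType) (b : T -> R) :=
  forall c : T -> K, \sum_i io (c i) * b i = 0 -> forall i, c i = 0.

Lemma span_dependence (T S : finType) (F : K -> Prop) (b : T -> R) (x : S -> R) :
  subfield F -> (forall i, span F b (x i)) -> (#|T| < #|S|)%N ->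
  exists c : S -> K, [/\ forall i, F (c i), exists i, c i != 0
                       & \sum_i io (c i) * x i = 0].
Proof.
move=> sF bx TS.
have /choice[A HA] : forall i, exists c : T -> K,
    (forall j, F (c j)) /\ x i = \sum_j io (c j) * b j.
  by move=> i; have [c ? ?] := bx i; exists c.
have [c [Fc nc cA]] := field_dependence sF TS (fun i => (HA i).1).
exists c; split=> //.
under eq_bigr => i _ do rewrite (HA i).2 mulr_sumr.
rewrite exchange_big /= big1 // => j _.
under eq_bigr => i _ do rewrite mulrA -rmorphM.
by rewrite -mulr_suml -rmorph_sum cA rmorph0 mul0r.
Qed.

Lemma span_independent_card (T S : finType) (F : K -> Prop) (b : T -> R) (x : S -> R) :
  subfield F -> (forall i, span F b (x i)) -> independent x -> (#|S| <= #|T|)%N.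
Proof.
move=> sF bx ix; rewrite leqNgt; apply/negP => TS.
have [c [_ [i ci] cx]] := span_dependence sF bx TS.
by move: ci; rewrite (ix _ cx) eqxx.
Qed.

Section Closure.
Variables (T : finType) (F : K -> Prop) (b : T -> R).
Hypothesis sF : subfield F.
Let rF := subfield_subring sF.

Lemma span_base i : span F b (b i).
Proof.
exists (fun j => (j == i)%:R) => [j|].
  by case: eqP => _; [exact: subring1|exact: subring0].
rewrite (bigD1 i) //= eqxx rmorph1 mul1r big1 ?addr0 // => j /negbTE->.
by rewrite rmorph0 mul0r.
Qed.

Lemma spanB x y : span F b x -> span F b y -> span F b (x - y).
Proof.
move=> [c Fc ->] [c' Fc' ->]; exists (fun i => c i - c' i) => [i|].
  exact: subringB.
by rewrite -sumrB; apply: eq_bigr => i _; rewrite rmorphB mulrBl.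
Qed.

Lemma spanZ a x : F a -> span F b x -> span F b (io a * x).
Proof.
move=> Fa [c Fc ->]; exists (fun i => a * c i) => [i|]; first exact: subringM.
by rewrite mulr_sumr; apply: eq_bigr => i _; rewrite rmorphM mulrA.
Qed.

Lemma span0 : span F b 0.
Proof.
exists (fun=> 0) => [i|]; first exact: subring0.
by rewrite big1 // => i _; rewrite rmorph0 mul0r.
Qed.

Lemma spanD x y : span F b x -> span F b y -> span F b (x + y).
Proof.
move=> Fx Fy; rewrite -[y]opprK; apply: spanB => //.
by rewrite -sub0r; apply: spanB => //; apply: span0.
Qed.

Lemma span_sum I (r : seq I) (P : pred I) (f : I -> R) :
  (forall i, P i -> span F b (f i)) -> span F b (\sum_(i <- r | P i) f i).
Proof. by move=> H; apply: big_ind => //; [exact: span0|exact: spanD]. Qed.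

Lemma span_subring :
  span F b 1 -> (forall i j, span F b (b i * b j)) -> subring (span F b).
Proof.
move=> b1 bM; split=> // [|_ _ [c Fc ->] [c' Fc' ->]]; first exact: spanB.
rewrite mulr_suml; apply: span_sum => i _; rewrite mulr_sumr.
apply: span_sum => j _; rewrite -mulrA (mulrA (b i)) -ioC.
by rewrite mulrA mulrA -rmorphM -mulrA; apply: spanZ => //; apply: subringM.
Qed.

(* If [x != 0], the lowest term of a linear relation between the powers of [x]
   is a multiple of [x]. *)
Lemma span_division (B : R -> Prop) :
  subring B -> scalar_closed io F B -> (forall x, B x -> span F b x) ->
  (forall x y, B x -> B y -> x != 0 -> x * y = 0 -> y = 0) -> division B.
Proof.
move=> sB FB Bb dom x Bx nx.
have [|c [Fc [i ci] cx]] := @span_dependence T 'I_(#|T|).+1 F b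
   (fun i => x ^+ i) sF (fun i => Bb _ (subringX sB i Bx)).
  by rewrite card_ord.
have xX k y : B y -> x ^+ k * y = 0 -> y = 0.
  move=> By; elim: k => [|k IH]; first by rewrite mul1r.
  rewrite exprS -mulrA => E; apply: IH; apply: (dom x) => //.
  by apply: (subringM sB) => //; exact: subringX.
pose l := [arg min_(k < i | c k != 0) (k : nat)].
have [nl lmin] : c l != 0 /\ forall k, c k != 0 -> (l <= k)%N.
  by rewrite /l; case: arg_minnP.
pose y := \sum_(k < #|T|.+1 | (l < k)%N) io (c k) * x ^+ (k - l.+1).
have By : B y.
  by apply: (subring_sum sB) => k _; apply: (subringM sB); [apply: FB|apply: subringX].
have E : io (c l) + y * x = 0.
  apply: (xX l).
    by apply: (subringD sB); [apply: FB|apply: (subringM sB)].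
  rewrite -[RHS]cx (bigD1 l) //= mulrDr -ioC; congr (_ + _).
  rewrite /y mulr_suml mulr_sumr [RHS](bigID (fun k : 'I__ => (l < k)%N)) /=.
  rewrite [X in _ = _ + X]big1 ?addr0; last first.
    move=> k /andP[kl lk]; have [->|/lmin H] := eqVneq (c k) 0; first by rewrite rmorph0 mul0r.
    by case/eqP: kl; apply/val_inj/eqP; rewrite eqn_leq H leqNgt lk.
  apply: eq_big => [k|k lk].
    by apply/idP/andP => [lk|[]//]; split=> //; apply: contraTneq lk => ->; rewrite ltnn.
  by rewrite -(mulrA (io (c k))) -exprSr mulrA -ioC -mulrA -exprD subnSK // subnKC // ltnW.
exists (- io (c l)^-1 * y).
  by apply: (subringM sB) => //; apply: (subringN sB); apply: FB; exact: subfieldV.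
by rewrite -mulrA mulNr -mulrN -(ioVl io nl); congr (_ * _); apply/eqP; rewrite eq_sym -addr_eq0 E.
Qed.

End Closure.
End Span.

Lemma poly_in_lead_mul (R : nzRingType) (B : R -> Prop) (P Q : {poly R}) :
  division B -> poly_in B P -> P != 0 -> Q != 0 ->
  lead_coef P * lead_coef Q != 0.
Proof.
move=> dB BP nP; apply: contra_neq => /(division_regular dB (BP _)) E.
by apply/eqP; rewrite -lead_coef_eq0 E // lead_coef_eq0.
Qed.

(** * Division algebras under extension of scalars *)

Section DivisionAlgebra.
Variables (K : fieldType) (R : nzRingType) (io : {rmorphism K -> R}).
Hypothesis ioC : forall a x, io a * x = x * io a.
Variables (T : finType) (b : T -> R).
Hypothesis ib : independent io b.

(** [B] is only contained in the span of [b], so that subalgebras of [D] qualify with the same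
    [b]. *)
Definition division_algebra (F : K -> Prop) (B : R -> Prop) :=
  [/\ subfield F, subring B, scalar_closed io F B,
      forall x, B x -> span io F b x & division B].

(** In coordinates with respect to [b], evaluation at [io t] becomes evaluation at [t] of finitely
    many polynomials over [F]. *)
Lemma poly_in_transcendental (F : K -> Prop) (B : R -> Prop) t P :
  transcendental F t -> subfield F -> (forall x, B x -> span io F b x) ->
  poly_in B P -> P.[io t] = 0 -> P = 0.
Proof.
move=> Ht sF Bb BP P0.
have /choice[c Hc] : forall k, exists c : T -> K,
    (forall j, F (c j)) /\ P`_k = \sum_j io (c j) * b j.
  by move=> k; have [c ? ?] := Bb _ (BP k); exists c.
pose p i := \poly_(k < size P) c k i.
have p0 i : p i = 0.
  apply: Ht => [k|].
    by rewrite coef_poly; case: ifP => _; [exact: (Hc k).1 | exact: subring0 (subfield_subring sF)].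
  move: i; apply: ib; rewrite -[RHS]P0 horner_coef.
  under eq_bigr => i _ do rewrite horner_poly rmorph_sum mulr_suml.
  rewrite exchange_big; apply: eq_bigr => k _; rewrite (Hc k).2 mulr_suml.
  by apply: eq_bigr => i _; rewrite rmorphM rmorphXn -!mulrA -rmorphXn (ioC _ (b i)).
apply/polyP => k; rewrite coef0.
have [lt|] := ltnP k (size P); last by move=> ?; rewrite nth_default.
rewrite (Hc k).2 big1 // => i _.
by have := congr1 (coefp k) (p0 i); rewrite /= coef_poly lt coef0 => ->; rewrite rmorph0 mul0r.
Qed.

Lemma adjoin_span (F : K -> Prop) (B : R -> Prop) t x :
  subfield F -> (forall x, B x -> span io F b x) ->
  adjoin io F B t x -> span io (adjoin_field F t) b x.
Proof.
move=> sF Bb [P [c [BP Fc nc ->]]].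
have sFt := adjoin_subfield t sF; have rFt := subfield_subring sFt.
have tg := adjoin_field_gen t sF.
apply: (spanZ sFt).
  apply: subfieldV => //; apply: (poly_in_horner rFt) => // i.
  exact: adjoin_field_base.
rewrite horner_coef; apply: (span_sum sFt) => i _.
rewrite -rmorphXn -ioC; apply: (spanZ sFt); first exact: subringX.
have [e Fe ->] := Bb _ (BP i); exists e => // j; exact: adjoin_field_base.
Qed.

(** Once the central denominators are removed, a product that vanishes lifts to [B[X]], where the
    leading coefficients have a nonzero product. A domain of finite dimension is division. *)
Lemma adjoin_division_algebra F B t :
  transcendental F t -> division_algebra F B ->
  division_algebra (adjoin_field F t) (adjoin io F B t).
Proof.
move=> Ht [sF sB FB Bb dB].
have sFt := adjoin_subfield t sF.
have sBt := adjoin_subring ioC t sF sB FB.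
have FBt : scalar_closed io _ (adjoin io F B t) := adjoin_scalar FB.
have Bbt x := @adjoin_span F B t x sF Bb.
split=> //; apply: (span_division ioC sFt sBt FBt Bbt).
move=> _ _ [P [c [BP Fc nc ->]]] [Q [e [BQ Fe ne ->]]] nx.
have -> : io c.[t]^-1 * P.[io t] * (io e.[t]^-1 * Q.[io t]) =
    io (c.[t]^-1 * e.[t]^-1) * (P.[io t] * Q.[io t]).
  by rewrite rmorphM -!mulrA; congr (_ * _); rewrite !mulrA -ioC.
move=> /io_regular H.
have /H : c.[t]^-1 * e.[t]^-1 != 0 by rewrite mulf_neq0 // invr_eq0.
rewrite -central_hornerM // => /poly_in_transcendental E.
have PQ : P * Q = 0 by apply: E Ht sF Bb _; apply: (subringM (poly_in_subring sB)).
have nP : P != 0 by apply: contraNneq nx => ->; rewrite horner0 mulr0.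
have [->|nQ] := eqVneq Q 0; first by rewrite horner0 mulr0.
have := poly_in_lead_mul dB BP nP nQ.
have := size_proper_mul (poly_in_lead_mul dB BP nP nQ).
rewrite PQ size_poly0 => /esym/eqP.
move: nP nQ; rewrite -!size_poly_gt0.
by case: (size P) => // ?; case: (size Q) => // ?; rewrite addnS.
Qed.

End DivisionAlgebra.

(** * Monomials in anticommuting elements *)

Section Monomials.
Variable R : nzRingType.
Implicit Types (w : nat -> R) (m : nat -> bool).

Definition anticommuting w r :=
  forall i j, (i < r)%N -> (j < r)%N -> i != j -> w i * w j = - (w j * w i).

Definition monomial w r m := \prod_(i < r) (if m i then w i else 1).

(** Every factor other than [w k] contributes one sign when [w k] is moved across the monomial;
    [w k] itself contributes none. *)
Definition commutation_sign r k m : nat := \sum_(i < r) (m i && (i != k :> nat)).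

Lemma monomial_sign w r s k m : anticommuting w s -> (r <= s)%N -> (k < s)%N ->
  w k * monomial w r m = (-1) ^+ commutation_sign r k m * monomial w r m * w k.
Proof.
move=> aw rs ks; elim: r rs => [|r IH] rs; rewrite /monomial /commutation_sign.
  by rewrite !big_ord0 mulr1 !mul1r.
rewrite !big_ord_recr /= -/(monomial _ _ _) -/(commutation_sign _ _ _).
rewrite mulrA IH ?(ltnW rs) // exprD -!mulrA; congr (_ * _).
case: (m r) => /=; last by rewrite !mul1r mulr1.
have [<-|rk] := eqVneq r k; first by rewrite mul1r.
by rewrite aw 1?eq_sym // expr1 mulN1r mulrN.
Qed.

Lemma eq_monomial w r m m' : (forall i, (i < r)%N -> m i = m' i) ->
  monomial w r m = monomial w r m'.
Proof. by move=> E; apply: eq_bigr => i _; rewrite E. Qed.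

Lemma monomial_gen w r k : (k < r)%N -> monomial w r (pred1 k) = w k.
Proof.
elim: r => // r IH; rewrite ltnS /monomial big_ord_recr /= -/(monomial w r (pred1 k)).
rewrite leq_eqVlt => /orP[/eqP->|lt].
  rewrite eqxx (_ : monomial _ _ _ = 1) ?mul1r // /monomial big1 // => i _.
  by rewrite /= ltn_eqF.
by rewrite IH // gtn_eqF ?mulr1.
Qed.

Lemma monomial1 w r : monomial w r (fun=> false) = 1.
Proof. by rewrite /monomial big1. Qed.

Variables (K : fieldType) (io : {rmorphism K -> R}).
Hypothesis ioC : forall a x, io a * x = x * io a.

(** Structure constants of a Clifford algebra: the [i]-th factor of the first monomial crosses the
    factors of smaller index of the second one, which gives the sign, and may then meet its twin,
    which gives [d i]. *)
Definition monomial_coef (d : nat -> K) r m m' : K :=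
  \prod_(i < r) ((-1) ^+ (m i * commutation_sign i i m')
                 * (if m i && m' i then d i else 1)).

Lemma monomialM w (d : nat -> K) r m m' :
  anticommuting w r -> (forall i, (i < r)%N -> w i * w i = io (d i)) ->
  monomial w r m * monomial w r m' =
  io (monomial_coef d r m m') * monomial w r (fun i => m i (+) m' i).
Proof.
move=> aw dw; have : (r <= r)%N by [].
elim: {1 3 4 5 6}r => [|k IH] kr; rewrite /monomial /monomial_coef.
  by rewrite !big_ord0 rmorph1.
rewrite !big_ord_recr /= -!/(monomial _ _ _) -!/(monomial_coef _ _ _ _).
have H : (if m k then w k else 1) * monomial w k m' =
   (-1) ^+ (m k * commutation_sign k k m') * monomial w k m' * (if m k then w k else 1).
  case: (m k); last by rewrite !mul1r mulr1.
  by rewrite mul1n; apply: (monomial_sign _ aw) => //; apply: ltnW.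
have H' : (if m k then w k else 1) * (if m' k then w k else 1) =
   io (if m k && m' k then d k else 1) * (if m k (+) m' k then w k else 1).
  by case: (m k); case: (m' k); rewrite /= ?rmorph1 ?mul1r ?mulr1 ?dw.
rewrite -mulrA (mulrA _ (monomial w k m')) H -!mulrA H' -(rmorphN1 io) -(rmorphXn io).
rewrite !rmorphM -!mulrA (mulrA (monomial w k m)) -(ioC _ (monomial w k m)) -!mulrA.
rewrite (mulrA (monomial w k m)) IH ?(ltnW kr) // -!mulrA (mulrA _ (io _)) -ioC.
by rewrite !mulrA -(mulrA _ (monomial w k _)) -(ioC _ (monomial w k _)) mulrA.
Qed.

Lemma monomial_coef_in (F : K -> Prop) d r m m' : subring F ->
  (forall i, (i < r)%N -> F (d i)) -> F (monomial_coef d r m m').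
Proof.
move=> sF Fd; apply: (subring_prod sF) => i _; apply: (subringM sF).
  by apply: (subringX sF); apply: (subringN sF); apply: subring1.
by case: ifP => _; [apply: Fd|apply: subring1].
Qed.

Lemma monomial_coef_neq0 d r m m' : (forall i, (i < r)%N -> d i != 0) ->
  monomial_coef d r m m' != 0.
Proof.
move=> nd; apply/prodf_neq0 => i _; rewrite mulf_neq0 ?signr_eq0 //.
by case: ifP => _; rewrite ?nd ?oner_neq0.
Qed.

Definition bits r (f : {ffun 'I_r -> bool}) (i : nat) : bool :=
  if insub i is Some j then f j else false.

Lemma bitsE r (f : {ffun 'I_r -> bool}) (i : 'I_r) : bits f i = f i.
Proof. by rewrite /bits valK. Qed.

Lemma bits_ffun r m i : (i < r)%N -> bits [ffun j : 'I_r => m j] i = m i.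
Proof. by move=> lt; rewrite (bitsE _ (Ordinal lt)) ffunE. Qed.

Definition monomials w r (f : {ffun 'I_r -> bool}) := monomial w r (bits f).

Lemma card_monomials r : #|{ffun 'I_r -> bool}| = (2 ^ r)%N.
Proof. by rewrite card_ffun card_bool card_ord. Qed.

Lemma span_monomial (F : K -> Prop) w r m : subfield F ->
  span io F (@monomials w r) (monomial w r m).
Proof.
move=> sF; have -> : monomial w r m = monomials w [ffun j : 'I_r => m j].
  by apply: eq_monomial => i lt; rewrite bits_ffun.
exact: span_base.
Qed.

Lemma monomial_span_subring (F : K -> Prop) w d r : subfield F ->
  anticommuting w r -> (forall i, (i < r)%N -> w i * w i = io (d i)) ->
  (forall i, (i < r)%N -> F (d i)) -> subring (span io F (@monomials w r)).
Proof.
move=> sF aw dw Fd; apply: (span_subring ioC sF).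
  by rewrite -(monomial1 w r); apply: span_monomial.
move=> f g; rewrite /monomials (monomialM _ _ aw dw).
apply: (spanZ sF); last exact: span_monomial.
by apply: monomial_coef_in => //; apply: subfield_subring.
Qed.

Lemma monomial_span_scalar (F : K -> Prop) w r : subfield F ->
  scalar_closed io F (span io F (@monomials w r)).
Proof.
move=> sF a Fa; rewrite -[io a]mulr1 -(monomial1 w r).
by apply: (spanZ sF) => //; apply: span_monomial.
Qed.

Lemma monomial_in (B : R -> Prop) w r m : subring B ->
  (forall i, (i < r)%N -> B (w i)) -> B (monomial w r m).
Proof.
move=> sB Bw; apply: (subring_prod sB) => i _.
by case: ifP => _; [exact: Bw|exact: subring1].
Qed.

Hypothesis two : 2%:R != 0 :> K.

(** The [e i] are eigenvectors of conjugation by each [w k], with eigenvalues 1 and -1. As 2 is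
    invertible, a relation splits into its components for the simultaneous eigenvalues; [i0] selects
    one of them. *)
Lemma character_split (T : finType) (e : T -> R) w (s : nat -> T -> nat) n c i0 :
  (forall k x, (k < n)%N -> x * w k = 0 -> x = 0) ->
  (forall k i, (k < n)%N -> w k * e i = (-1) ^+ s k i * e i * w k) ->
  \sum_i io (c i) * e i = 0 ->
  \sum_(i | [forall k : 'I_n, odd (s k i) == odd (s k i0)]) io (c i) * e i = 0.
Proof.
move=> wreg we ce; have : (n <= n)%N by [].
elim: {-2}n => [|k IH] kn.
  rewrite -[RHS]ce; apply: eq_bigl => i.
  by apply/forallP => -[].
set P := fun i => [forall j : 'I_k, odd (s j i) == odd (s j i0)].
have {}IH : \sum_(i | P i) io (c i) * e i = 0 by apply: IH; apply: ltnW.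
have split2 : \sum_(i | P i && ~~ odd (s k i)) io (c i) * e i = 0
           /\ \sum_(i | P i && odd (s k i)) io (c i) * e i = 0.
  set X := \sum_(i | _) _; set Y := \sum_(i | _) _.
  have YX : Y + X = 0 by rewrite -[RHS]IH [in RHS](bigID (fun i => odd (s k i))).
  have XY : X - Y = 0.
    apply: (wreg k _ kn); have := congr1 (fun x => w k * x) IH.
    rewrite mulr0 => <-; rewrite mulrBl [in RHS](bigID (fun i => odd (s k i))) /= mulrDr.
    rewrite addrC; congr (_ + _).
      rewrite mulr_sumr mulr_suml -sumrN; apply: eq_bigr => i /andP[_ o].
      by rewrite mulrA -ioC -mulrA we // -signr_odd o expr1 mulN1r !mulNr mulrN mulrA.
    rewrite mulr_sumr mulr_suml; apply: eq_bigr => i /andP[_ /negbTE o].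
    by rewrite mulrA -ioC -mulrA we // -signr_odd o mul1r mulrA.
  have X0 : X = 0.
    apply: (io_regular (io := io) two); rewrite rmorph_nat mulr_natl mulr2n.
    have -> : X + X = (X - Y) + (Y + X) by rewrite addrA subrK.
    by rewrite XY YX addr0.
  by split=> //; move: YX; rewrite X0 addr0.
have E i : [forall j : 'I_k.+1, odd (s j i) == odd (s j i0)] =
   P i && (odd (s k i) == odd (s k i0)).
  apply/forallP/andP => [H|[/forallP H1 H2] j].
    split; last exact: (H ord_max).
    by apply/forallP => j; apply: (H (widen_ord (leqnSn k) j)).
  have [jk|] := ltnP j k; first exact: (H1 (Ordinal jk)).
  move: (ltn_ord j); rewrite ltnS => jk kj.
  by have -> : j = k :> nat by apply/eqP; rewrite eqn_leq jk.
under eq_bigl => i do rewrite E.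
case: (odd (s k i0)); first by under eq_bigl => i do rewrite eqb_id; apply: split2.2.
by under eq_bigl => i do rewrite eqbF_neg; apply: split2.1.
Qed.

(** The sign at [k] and the parity of the degree determine [f k], so equal signs leave equal or
    complementary monomials. Complementary ones would have degrees of different parity, but these
    add up to the even number [r]. For odd [r] the product of all generators commutes with
    everything. *)
Lemma commutation_sign_inj r (f g : {ffun 'I_r -> bool}) : ~~ odd r ->
  (forall k : 'I_r, odd (commutation_sign r k (bits f)) =
                    odd (commutation_sign r k (bits g))) -> f = g.
Proof.
move=> er H.
have S (h : {ffun 'I_r -> bool}) (k : 'I_r) :
    (\sum_(i < r) h i = h k + commutation_sign r k (bits h))%N.
  rewrite (bigD1 k) //=; congr (_ + _)%N; rewrite /commutation_sign [RHS](bigD1 k) //=.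
  rewrite eqxx andbF add0n; apply: eq_bigr => i ik.
  by rewrite bitsE -[(i != k :> nat)]/(i != k) ik andbT.
have D k : f k (+) g k = odd (\sum_(i < r) f i) (+) odd (\sum_(i < r) g i).
  rewrite (S f k) (S g k) !oddD !oddb H.
  by case: (f k); case: (g k); case: (odd _).
apply/ffunP => k; case Ec: (odd (\sum_(i < r) f i) (+) odd (\sum_(i < r) g i)) D => D; last first.
  by have := D k; case: (f k); case: (g k).
have : odd (\sum_(i < r) f i + \sum_(i < r) g i) = odd r.
  rewrite -big_split /= (eq_bigr (fun=> 1%N)) ?sum1_card ?card_ord // => i _.
  by have := D i; case: (f i); case: (g i).
by rewrite oddD Ec (negbTE er).
Qed.

Lemma monomial_regular w d r m c :
  anticommuting w r -> (forall i, (i < r)%N -> w i * w i = io (d i)) ->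
  (forall i, (i < r)%N -> d i != 0) -> io c * monomial w r m = 0 -> c = 0.
Proof.
move=> aw dw nd E.
have := congr1 (fun x => x * monomial w r m) E; rewrite mul0r -mulrA (monomialM _ _ aw dw).
rewrite (_ : monomial w r (fun i => m i (+) m i) = 1); last first.
  by rewrite -(monomial1 w r); apply: eq_monomial => i _; rewrite addbb.
rewrite mulr1 -rmorphM => /eqP; rewrite fmorph_eq0 mulf_eq0.
by rewrite (negbTE (monomial_coef_neq0 _ _ nd)) orbF => /eqP.
Qed.

Lemma monomials_independent w d r : ~~ odd r ->
  anticommuting w r -> (forall i, (i < r)%N -> w i * w i = io (d i)) ->
  (forall i, (i < r)%N -> d i != 0) -> independent io (@monomials w r).
Proof.
move=> er aw dw nd c ce f.
have wreg k x : (k < r)%N -> x * w k = 0 -> x = 0.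
  move=> kr E; apply: (io_regular (io := io) (nd k kr)).
  by rewrite ioC -dw // mulrA E mul0r.
have := character_split f wreg
  (fun k g kr => monomial_sign (bits g) aw (leqnn r) kr) ce.
rewrite (big_pred1 f) => [|g]; first exact: monomial_regular aw dw nd.
apply/forallP/eqP => [H|-> //].
by apply: commutation_sign_inj => // k; apply/eqP.
Qed.

(** [monomials_independent] covers even numbers of generators; dropping the last generator reaches
    the odd ones, such as the [r] of the construction. *)
Lemma monomials_independentS w r :
  independent io (@monomials w r.+1) -> independent io (@monomials w r).
Proof.
move=> iw c ce f.
pose g := [ffun j : 'I_r.+1 => bits f j].
pose c' (h : {ffun 'I_r.+1 -> bool}) :=
  if h ord_max then 0 else c [ffun j : 'I_r => bits h j].
have gf : [ffun j : 'I_r => bits g j] = f.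
  by apply/ffunP => j; rewrite ffunE bits_ffun ?bitsE // ltnS ltnW.
have gm : g ord_max = false by rewrite ffunE /bits insubF //= ltnn.
have <- : c' g = c f by rewrite /c' gm gf.
apply: iw; rewrite (bigID (fun h : {ffun 'I_r.+1 -> bool} => h ord_max)) /=.
rewrite big1 ?add0r => [|h hm]; last by rewrite /c' hm rmorph0 mul0r.
rewrite -[RHS]ce (reindex (fun k : {ffun 'I_r -> bool} =>
  [ffun j : 'I_r.+1 => bits k j])) /=; last first.
  exists (fun h => [ffun j : 'I_r => bits h j]) => [k _|h].
    by apply/ffunP => j; rewrite ffunE bits_ffun ?bitsE // ltnS ltnW.
  rewrite inE => hm; apply/ffunP => j; rewrite ffunE.
  have [jr|rj] := ltnP j r; first by rewrite bits_ffun // bitsE.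
  have -> : j = ord_max by apply/val_inj/eqP; rewrite eqn_leq rj -ltnS ltn_ord.
  by rewrite /bits insubF /= ?ltnn // (negbTE hm).
have km (k : {ffun 'I_r -> bool}) : [ffun j : 'I_r.+1 => bits k j] ord_max = false.
  by rewrite ffunE /bits insubF //= ltnn.
apply: eq_big => [k|k _]; first by rewrite km.
rewrite /c' km; congr (io (c _) * _).
  by apply/ffunP => j; rewrite ffunE bits_ffun ?bitsE // ltnS ltnW.
rewrite /monomials /monomial big_ord_recr /= (_ : bits _ r = false) ?mulr1.
  by apply: eq_bigr => i _; rewrite bits_ffun // ltnS ltnW.
by rewrite (bitsE _ ord_max) km.
Qed.

End Monomials.

(** * Descent of Clifford systems *)

Lemma poly_in_size_sqr (R : nzRingType) (B : R -> Prop) (P : {poly R}) n :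
  division B -> poly_in B P -> (size (P * P)%R <= n.*2.+1)%N -> (size P <= n.+1)%N.
Proof.
move=> dB BP; have [->|nP] := eqVneq P 0; first by rewrite size_poly0.
rewrite (size_proper_mul (poly_in_lead_mul dB BP nP nP)).
move: nP; rewrite -size_poly_gt0; case: (size P) => // k _.
by rewrite addSn addnS addnn /= !ltnS leq_double.
Qed.

(* A nonzero element of minimal degree generates the right ideal [J]. *)
Lemma right_ideal_principal (R : nzRingType) (B : R -> Prop) (J : {poly R} -> Prop) :
  subring B -> division B -> (forall G, J G -> poly_in B G) ->
  (forall G H, J G -> J H -> J (G - H)) ->
  (forall G H, J G -> poly_in B H -> J (G * H)) ->
  (exists2 G, J G & G != 0) ->
  exists g, [/\ J g, g != 0 & forall G, J G -> exists2 H, poly_in B H & G = g * H].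
Proof.
move=> sB dB JB Jsub Jmul [G0 JG0 nG0].
have pB := poly_in_subring sB.
have ex : exists n, `[< exists g, [/\ J g, g != 0 & size g = n] >].
  by exists (size G0); apply/asboolP; exists G0.
case: (ex_minnP ex) => n /asboolP[g [Jg ng sg]] nmin.
exists g; split=> // G; have [k] := ubnP (size G); elim: k => // k IH in G *.
rewrite ltnS => sG JG; have [G0'|nG] := eqVneq G 0.
  by exists 0; rewrite ?mulr0 //; apply: subring0.
have gG : (size g <= size G)%N by rewrite sg; apply: nmin; apply/asboolP; exists G.
have [a [Ba _ ga]] : exists a, [/\ B a, a * lead_coef g = 1 & lead_coef g * a = 1].
  by apply: (division_inverse dB); [apply: JB|rewrite lead_coef_eq0].
pose H := (a * lead_coef G)%:P * 'X^(size G - size g).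
have BH : poly_in B H.
  apply: (subringM pB); last by apply: (subringX pB); apply: poly_inX.
  by apply: (poly_inC sB); apply: (subringM sB) => //; apply: JB.
have JG1 : J (G - g * H) by apply: Jsub => //; apply: Jmul.
have [|H1 BH1 E] := IH _ _ JG1.
  rewrite (leq_trans _ sG) // -[X in (_ < X)%N]prednK ?size_poly_gt0 // ltnS.
  apply/leq_sizeP => j Gj; rewrite coefB /H mulrA coefMXn coefMC.
  have sg0 : (0 < size g)%N by rewrite size_poly_gt0.
  have sG0 : (0 < size G)%N by rewrite size_poly_gt0.
  have -> : (j < size G - size g)%N = false by apply/negbTE; rewrite -leqNgt; lia.
  move: Gj; rewrite leq_eqVlt => /orP[/eqP <-|Gj].
    have -> : ((size G).-1 - (size G - size g) = (size g).-1)%N by lia.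
    by rewrite -!lead_coefE mulrA ga mul1r subrr.
  have sGj : (size G <= j)%N by rewrite -(prednK sG0).
  have -> : G`_j = 0 by rewrite nth_default.
  have -> : g`_(j - (size G - size g)) = 0.
    by rewrite nth_default // leq_subRL ?(leq_trans (leq_subr _ _) sGj) // subnK.
  by rewrite mul0r subrr.
exists (H + H1); first exact: (subringD pB).
by rewrite mulrDr -E addrC subrK.
Qed.

Section CommonDenominator.
Variables (K : fieldType) (R : nzRingType) (io : {rmorphism K -> R}).
Hypothesis ioC : forall a x, io a * x = x * io a.
Variables (F : K -> Prop) (B : R -> Prop) (t : K).
Hypotheses (sF : subfield F) (sB : subring B) (FB : scalar_closed io F B).
Let pB := poly_in_subring sB.
Let pF := poly_in_subring (subfield_subring sF).

Lemma common_denominator (S : finType) (e : S -> R) :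
  (forall i, adjoin io F B t (e i)) ->
  exists2 c : {poly K}, poly_in F c /\ c.[t] != 0 &
    forall i, exists2 P, poly_in B P & io c.[t] * e i = P.[io t].
Proof.
move=> /choice[P /choice[c H]].
exists (\prod_i c i); first split.
- by apply: (subring_prod pF) => i _; case: (H i).
- by rewrite horner_prod; apply/prodf_neq0 => i _; case: (H i).
move=> i; exists (map_poly io (\prod_(j | j != i) c j) * P i).
  apply: (subringM pB); last by case: (H i).
  by apply: (poly_in_map FB); apply: (subring_prod pF) => j _; case: (H j).
rewrite central_hornerM // horner_map (bigD1 i) //= hornerM mulrC rmorphM -!mulrA.
by have [_ _ nc ->] := H i; rewrite (mulrA (io (c i).[t])) ioV // mul1r.
Qed.

End CommonDenominator.

Section Descent.
Variables (K : fieldType) (R : nzRingType) (io : {rmorphism K -> R}).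
Hypothesis ioC : forall a x, io a * x = x * io a.
Variables (T : finType) (b : T -> R).
Hypothesis ib : independent io b.

(* When the [l`_i] are nonzero, the [z i] generate an image of the even Clifford
   algebra of [<1, - l`_0, - l`_1, ...>]. *)
Definition clifford_system (B : R -> Prop) (l : seq K) :=
  exists z : nat -> R, [/\ forall i, (i < size l)%N -> B (z i),
    forall i, (i < size l)%N -> z i * z i = io l`_i & anticommuting z (size l)].

Variables (F : K -> Prop) (B : R -> Prop) (t : K).
Hypotheses (dA : division_algebra io b F B) (Ht : transcendental F t).

Let sF : subfield F. Proof. by case: dA. Qed.
Let rF := subfield_subring sF.
Let sB : subring B. Proof. by case: dA. Qed.
Let dB : division B. Proof. by case: dA. Qed.
Let FB : scalar_closed io F B. Proof. by case: dA. Qed.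
Let pB := poly_in_subring sB.
Let pF := poly_in_subring rF.

Lemma poly_in_eq P Q : poly_in B P -> poly_in B Q -> P.[io t] = Q.[io t] -> P = Q.
Proof.
move=> BP BQ E; apply/eqP; rewrite -subr_eq0; apply/eqP.
have Bb : forall x, B x -> span io F b x by case: dA.
apply: (poly_in_transcendental ioC ib Ht sF Bb); first exact: (subringB pB).
by rewrite hornerD hornerN E subrr.
Qed.

Lemma poly_in_mulI P Q : poly_in B P -> P != 0 -> P * Q = 0 -> Q = 0.
Proof.
move=> BP nP PQ; have [//|nQ] := eqVneq Q 0.
have := poly_in_lead_mul dB BP nP nQ.
rewrite -lead_coef_proper_mul; last exact: poly_in_lead_mul dB BP nP nQ.
by rewrite PQ lead_coef0 eqxx.
Qed.

(* The elements [z i] stabilise the right [B[t]]-module spanned by their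
   monomials; if [g] generates it, then [g^-1 * z i * g] has polynomial
   coefficients. *)
Lemma anticommuting_descent (z : nat -> R) (delta : nat -> {poly K}) n :
  (forall i, (i < n)%N -> adjoin io F B t (z i)) ->
  (forall i, (i < n)%N -> poly_in F (delta i)) ->
  (forall i, (i < n)%N -> z i * z i = io (delta i).[t]) ->
  anticommuting z n ->
  exists Z : nat -> {poly R}, [/\ forall i, (i < n)%N -> poly_in B (Z i),
    forall i, (i < n)%N -> Z i * Z i = map_poly io (delta i) & anticommuting Z n].
Proof.
move=> Bz Fd dz az.
have sBt := adjoin_subring ioC t sF sB FB.
have [|c [Fc nc] cz] := common_denominator ioC (t := t) sF sB FB (e := @monomials R z n).
  by move=> f; apply: monomial_in.
pose L x := exists2 Q : {ffun 'I_n -> bool} -> {poly R},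
  forall f, poly_in B (Q f) & x = \sum_f monomials z f * (Q f).[io t].
have L0 : L 0.
  exists (fun=> 0) => [f|]; first exact: (subring0 pB).
  by rewrite big1 // => f _; rewrite horner0 mulr0.
have LB x y : L x -> L y -> L (x - y).
  move=> [Q BQ ->] [Q' BQ' ->]; exists (fun f => Q f - Q' f) => [f|].
    exact: (subringB pB).
  by rewrite -sumrB; apply: eq_bigr => f _; rewrite hornerD hornerN mulrBr.
have LD x y : L x -> L y -> L (x + y).
  by move=> Lx Ly; rewrite -[y]opprK; apply: (LB) => //; rewrite -sub0r; apply: LB.
have LM x Q : L x -> poly_in B Q -> L (x * Q.[io t]).
  move=> [Q' BQ' ->] BQ; exists (fun f => Q' f * Q) => [f|].
    exact: (subringM pB).
  by rewrite mulr_suml; apply: eq_bigr => f _; rewrite central_hornerM // mulrA.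
have Lmon m Q : poly_in B Q -> L (monomial z n m * Q.[io t]).
  move=> BQ; apply: LM => //; pose g := [ffun j : 'I_n => m j].
  exists (fun f => if f == g then 1 else 0) => [f|].
    by case: ifP => _; [exact: (subring1 pB)|exact: (subring0 pB)].
  rewrite (bigD1 g) //= eqxx hornerE mulr1 big1 ?addr0 => [|f /negbTE->].
    by apply: eq_monomial => i lt; rewrite bits_ffun.
  by rewrite horner0 mulr0.
(* The structure constants are products of signs and squares of the [z i], hence values at [t] of
   polynomials over [F]. So left multiplication by [z i] preserves [L]. *)
pose Ft x := exists2 p, poly_in F p & x = p.[t].
have rFt : subring Ft.
  split=> [|_ _ [p Fp ->] [q Fq ->]|_ _ [p Fp ->] [q Fq ->]].
  - by exists 1; rewrite ?hornerE //; apply: (subring1 pF).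
  - by exists (p - q); rewrite ?hornerE //; apply: (subringB pF).
  - by exists (p * q); rewrite ?hornerM //; apply: (subringM pF).
have Lz i x : (i < n)%N -> L x -> L (z i * x).
  move=> lt [Q BQ ->]; rewrite mulr_sumr; apply: (big_ind L) => // f _.
  rewrite mulrA -(monomial_gen z lt) (monomialM ioC _ _ az dz).
  have [p Fp ->] : Ft (monomial_coef (fun i => (delta i).[t]) n (pred1 i) (bits f)).
    by apply: monomial_coef_in => // j ltj; exists (delta j) => //; apply: Fd.
  rewrite ioC -mulrA -(horner_map io) -central_hornerM //.
  by apply: Lmon; apply: (subringM pB) => //; apply: (poly_in_map FB).
(* The common denominator [c] carries the module [L] into polynomials, where it becomes a right
   ideal. It is nonzero, for the empty monomial puts [c] into it. *)
pose J G := poly_in B G /\ exists2 x, L x & G.[io t] = io c.[t] * x.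
have LJ x : L x -> exists2 G, J G & G.[io t] = io c.[t] * x.
  move=> Lx; have [Q BQ E] := Lx.
  have /choice[P HP] : forall f : {ffun 'I_n -> bool}, exists P : {poly R},
      poly_in B P /\ io c.[t] * monomials z f = P.[io t].
    by move=> f; have [P ? ?] := cz f; exists P.
  have EG : (\sum_f P f * Q f).[io t] = io c.[t] * x.
    rewrite horner_sum E mulr_sumr; apply: eq_bigr => f _.
    by rewrite central_hornerM // mulrA (HP f).2.
  exists (\sum_f P f * Q f) => //; split; last by exists x.
  by apply: (subring_sum pB) => f _; apply: (subringM pB) => //; case: (HP f).
have [g [[Bg [x Lx Ex]] ng gJ]] : exists g, [/\ J g, g != 0 &
    forall G, J G -> exists2 H, poly_in B H & G = g * H].
  apply: (right_ideal_principal sB dB) => [G []//|G H|G H|].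
  - move=> [BG [x Lx Ex]] [BH [y Ly Ey]]; split; first exact: (subringB pB).
    by exists (x - y); [exact: LB|rewrite hornerD hornerN Ex Ey mulrBr].
  - move=> [BG [x Lx Ex]] BH; split; first exact: (subringM pB).
    by exists (x * H.[io t]); [exact: LM|rewrite central_hornerM // Ex mulrA].
  - exists (map_poly io c); last first.
      by rewrite map_poly_eq0; apply: contraNneq nc => ->; rewrite horner0.
    split; first exact: (poly_in_map FB Fc).
    exists 1; last by rewrite horner_map mulr1.
    have := Lmon (fun=> false) 1 (subring1 pB).
    by rewrite monomial1 !hornerE.
have /choice[Z HZ] : forall i, exists Z, (i < n)%N ->
    poly_in B Z /\ z i * g.[io t] = (g * Z).[io t].
  move=> i; have [lt|] := ltnP i n; last by exists 0.
  have [G JG EG] := LJ _ (Lz _ _ lt Lx); have [H BH E] := gJ _ JG.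
  by exists H; split=> //; rewrite -E EG Ex mulrA -ioC mulrA.
have BZ i : (i < n)%N -> poly_in B (Z i) by move=> lt; case: (HZ i lt).
have ZZ i j : (i < n)%N -> (j < n)%N ->
    (g * (Z i * Z j)).[io t] = z i * z j * g.[io t].
  move=> lti ltj; rewrite mulrA central_hornerM // -(HZ i lti).2.
  by rewrite -(mulrA (z i) g.[io t]) -central_hornerM // -(HZ j ltj).2 mulrA.
exists Z; split=> // [i lt|i j lti ltj ij].
  apply/eqP; rewrite -subr_eq0; apply/eqP; apply: (poly_in_mulI Bg ng).
  apply/eqP; rewrite mulrBr subr_eq0; apply/eqP; apply: poly_in_eq.
  - by apply: (subringM pB) => //; apply: (subringM pB); apply: BZ.
  - by apply: (subringM pB) => //; apply: (poly_in_map FB); apply: Fd.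
  - by rewrite ZZ // dz // ioC central_hornerM // horner_map.
apply/eqP; rewrite -subr_eq0 opprK; apply/eqP; apply: (poly_in_mulI Bg ng).
apply: poly_in_eq.
- by apply: (subringM pB) => //; apply: (subringD pB); apply: (subringM pB); apply: BZ.
- exact: (subring0 pB).
- by rewrite mulrDr hornerD !ZZ // az // mulNr addNr horner0.
Qed.

(** By [anticommuting_descent] the system may be taken in [B[X]]. Comparing degrees, the element
    with square [delta + d X^2] is linear, [w_0 + w_1 X], and the others are constant; comparing
    coefficients, [w_0] and [w_1] anticommute and have squares [delta] and [d]. *)
Lemma clifford_system_step delta d l : F delta -> F d ->
  (forall i, (i < size l)%N -> F l`_i) ->
  clifford_system (adjoin io F B t) ((delta + d * t ^+ 2) :: l) ->
  clifford_system B [:: delta, d & l].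
Proof.
move=> Fdelta Fd Fl [z [Bz dz az]].
pose D (i : nat) : {poly K} := if i is k.+1 then (l`_k)%:P else delta%:P + d%:P * 'X^2.
have [||Z [BZ DZ aZ]] := @anticommuting_descent z D (size l).+1 Bz _ _ az.
- move=> [|i] lt /=; last exact/(poly_inC rF)/Fl.
  apply: (subringD pF); first exact: poly_inC.
  apply: (subringM pF); first exact: poly_inC.
  by apply: (subringX pF); apply: poly_inX.
- by move=> [|i] lt; rewrite dz // /D /= !hornerE.
have sZ0 : (size (Z 0%N) <= 2)%N.
  apply: (poly_in_size_sqr (n := 1) dB (BZ 0%N isT)); rewrite DZ // size_map_poly.
  rewrite /D (leq_trans (size_polyD _ _)) // geq_max (leq_trans (size_polyC_leq1 _)) //=.
  by rewrite mul_polyC (leq_trans (size_scale_leq _ _)) // size_polyXn.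
have sZ i : (i < size l)%N -> (size (Z i.+1) <= 1)%N.
  move=> lt; apply: (poly_in_size_sqr (n := 0) dB (BZ i.+1 lt)).
  by rewrite DZ // size_map_poly size_polyC_leq1.
have Z02 : (Z 0%N)`_2 = 0 by rewrite nth_default.
have Z1 i : (i < size l)%N -> (Z i.+1)`_1 = 0 by move=> lt; rewrite nth_default ?sZ.
have coef1M (P Q : {poly R}) : (P * Q)`_1 = P`_0 * Q`_1 + P`_1 * Q`_0.
  by rewrite coefM !big_ord_recl big_ord0 addr0.
have coef2M (P Q : {poly R}) : (P * Q)`_2 = P`_0 * Q`_2 + (P`_1 * Q`_1 + P`_2 * Q`_0).
  by rewrite coefM !big_ord_recl big_ord0 addr0.
have DZ0 k : (Z 0%N * Z 0%N)`_k = io ((k == 0%N)%:R * delta + (k == 2)%:R * d).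
  rewrite DZ // coef_map /D coefD coefC coefCM coefXn; congr (io (_ + _)).
    by case: (k == 0%N); rewrite ?mul1r ?mul0r.
  by rewrite mulrC.
pose w (k : nat) := match k with 0%N => (Z 0%N)`_0 | 1%N => (Z 0%N)`_1 | k.+2 => (Z k.+1)`_0 end.
have w01 : w 0%N * w 1%N = - (w 1%N * w 0%N).
  have := DZ0 1%N; rewrite coef1M !mul0r addr0 rmorph0 /= => /eqP.
  by rewrite addr_eq0 => /eqP.
have w0 i : (i < size l)%N -> w 0%N * w i.+2 = - (w i.+2 * w 0%N).
  move=> lt; have := aZ 0%N i.+1 isT lt isT => /(congr1 (coefp 0)) /=.
  by rewrite coefN !coef0M.
have w1 i : (i < size l)%N -> w 1%N * w i.+2 = - (w i.+2 * w 1%N).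
  move=> lt; have := aZ 0%N i.+1 isT lt isT => /(congr1 (coefp 1)) /=.
  by rewrite coefN !coef1M Z1 // mul0r mulr0 add0r addr0.
exists w; split.
- by move=> [|[|i]] lt; apply: BZ.
- move=> [|[|i]] lt.
  + by have := DZ0 0%N; rewrite coef0M mul1r mul0r addr0.
  + by have := DZ0 2%N; rewrite coef2M Z02 mul1r !mul0r mulr0 addr0 !add0r.
  + have := congr1 (coefp 0) (DZ i.+1 lt).
    by rewrite /= coef0M coef_map coefC.
- move=> [|[|i]] [|[|j]] //= lti ltj ij.
  + exact: w0.
  + by rewrite w01 opprK.
  + exact: w1.
  + by rewrite w0 // opprK.
  + by rewrite w1 // opprK.
  + have := aZ i.+1 j.+1 lti ltj ij => /(congr1 (coefp 0)) /=.
    by rewrite coefN !coef0M.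
Qed.

End Descent.

(** * Function fields of quadrics *)

Section IteratedAdjunction.
Variables (K : fieldType).
Implicit Types (F : K -> Prop) (t : nat -> K).

Fixpoint adjoins_field F t m :=
  if m is k.+1 then adjoin_field (adjoins_field F t k) (t k) else F.

Definition independent_transcendentals F t m :=
  forall k, (k < m)%N -> transcendental (adjoins_field F t k) (t k).

Lemma independent_transcendentals_pred F t m :
  independent_transcendentals F t m.+1 -> independent_transcendentals F t m.
Proof. by move=> H k lt; apply: H; apply: ltnW. Qed.

Lemma adjoins_subfield F t m : subfield F -> subfield (adjoins_field F t m).
Proof. by move=> sF; elim: m => //= m IH; apply: adjoin_subfield. Qed.

Lemma adjoins_base F t m x : subfield F -> F x -> adjoins_field F t m x.
Proof.
move=> sF Fx; elim: m => //= m IH; apply: adjoin_field_base => //.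
exact: adjoins_subfield.
Qed.

Lemma adjoins_gen F t m i : subfield F -> (i < m)%N -> adjoins_field F t m (t i).
Proof.
move=> sF; elim: m => //= m IH; rewrite ltnS leq_eqVlt => /orP[/eqP->|lt].
  exact/adjoin_field_gen/adjoins_subfield.
by apply: adjoin_field_base; [exact: adjoins_subfield|exact: IH].
Qed.

Lemma adjoins_mono F F' t m x : (forall a, F a -> F' a) ->
  adjoins_field F t m x -> adjoins_field F' t m x.
Proof. by move=> FF; elim: m x => //= m IH x; apply: adjoin_mono. Qed.

Lemma independent_transcendentals_mono F F' t m : (forall a, F a -> F' a) ->
  independent_transcendentals F' t m -> independent_transcendentals F t m.
Proof.
move=> FF H k km; apply: transcendental_mono (H k km) => a; exact: adjoins_mono.
Qed.

Lemma adjoins_form F t (d : nat -> K) m : subfield F -> (forall i, F (d i)) ->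
  adjoins_field F t m (\sum_(i < m) d i * t i ^+ 2).
Proof.
move=> sF Fd; have sFt := subfield_subring (adjoins_subfield t m sF).
apply: (subring_sum sFt) => i _; apply: (subringM sFt); first exact: adjoins_base.
by apply: (subringX sFt); apply: adjoins_gen.
Qed.

Variables (R : nzRingType) (io : {rmorphism K -> R}).
Hypothesis ioC : forall a x, io a * x = x * io a.
Variables (T : finType) (b : T -> R).
Hypothesis ib : independent io b.

Fixpoint adjoins F (B : R -> Prop) t m :=
  if m is k.+1 then adjoin io (adjoins_field F t k) (adjoins F B t k) (t k) else B.

Lemma adjoins_division_algebra F B t m : independent_transcendentals F t m ->
  division_algebra io b F B ->
  division_algebra io b (adjoins_field F t m) (adjoins F B t m).
Proof.
move=> Ht dA; elim: m Ht => //= m IH Ht; apply: adjoin_division_algebra => //.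
  exact: Ht.
exact/IH/independent_transcendentals_pred.
Qed.

Lemma adjoins_algebra_base F B t m x : division_algebra io b F B ->
  independent_transcendentals F t m -> B x -> adjoins F B t m x.
Proof.
move=> dA Ht Bx; elim: m Ht => //= m IH /independent_transcendentals_pred Ht.
have [sF sB _ _ _] := adjoins_division_algebra Ht dA.
by apply: adjoin_base => //; apply: IH.
Qed.

(** The variables are peeled off from the last one down. The leading [0] is the empty sum that
    remains, and [clifford_system_behead] discards it. *)
Lemma clifford_system_descent F B t (d : nat -> K) m l :
  division_algebra io b F B -> independent_transcendentals F t m ->
  (forall i, F (d i)) -> (forall i, (i < size l)%N -> F l`_i) ->
  clifford_system io (adjoins F B t m) ((\sum_(i < m) d i * t i ^+ 2) :: l) ->
  clifford_system io B (0 :: mkseq d m ++ l).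
Proof.
move=> dA + Fd; elim: m l => [|m IH] l Ht Fl; first by rewrite big_ord0.
have Ht' := independent_transcendentals_pred Ht.
have sF : subfield F by case: dA.
rewrite mkseqS cat_rcons big_ord_recr /= => H.
have {}H : clifford_system io (adjoins F B t m) [:: \sum_(i < m) d i * t i ^+ 2, d m & l].
  apply: (clifford_system_step ioC ib _ _ _ _ _ H).
  - exact: adjoins_division_algebra.
  - exact: Ht.
  - exact: adjoins_form.
  - exact: adjoins_base.
  - by move=> i lt; apply: adjoins_base => //; apply: Fl.
apply: IH => // -[|i] lt; first exact: Fd.
exact: Fl.
Qed.

Lemma clifford_system_behead B a l :
  clifford_system io B (a :: l) -> clifford_system io B l.
Proof.
move=> [z [Bz dz az]]; exists (fun i => z i.+1); split=> [i lt|i lt|i j lti ltj ij].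
- exact: Bz.
- exact: dz.
- exact: az.
Qed.

(* The extension [adjoins_field F t m] followed by the square root of
   [\sum_i d i * t i ^+ 2] is a function field of the quadric
   [<-1, d 0, ..., d (m - 1)>]. *)
Lemma function_field_division F B t (d : nat -> K) m s :
  division_algebra io b F B -> independent_transcendentals F t m ->
  (forall i, F (d i)) -> s * s = \sum_(i < m) d i * t i ^+ 2 ->
  clifford_system io B (mkseq d m) \/
  division_algebra io b (quad_ext (adjoins_field F t m) s)
                        (quad_ext (adjoins F B t m) (io s)).
Proof.
move=> dA Ht Fd ss; have [sF sB FB Bb dB] := adjoins_division_algebra Ht dA.
have sF0 : subfield F by case: dA.
have Fss : adjoins_field F t m (s * s) by rewrite ss; apply: adjoins_form.
(* Adjoining the central [io s] keeps the algebra division unless [s * s] already has a square root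
   in it, and such a root is a Clifford system of length one. *)
have [[x Bx xs]|Hn] := pselect (exists2 x, adjoins F B t m x & x * x = io (s * s)).
  left; rewrite -[mkseq d m]cats0; apply: clifford_system_behead.
  apply: (clifford_system_descent dA Ht) => //.
  by exists (fun=> x); split=> [//|[|i] //= _|[|i] [|j] //=]; rewrite -ss.
right; have sQ := quad_ext_subfield sF Fss.
have [|||sBQ dBQ] := @quad_ext_division R (adjoins F B t m) (io s) id sB dB.
- by rewrite -rmorphM; apply: FB.
- by move=> y By; rewrite ioC.
- by move=> x Bx; apply/negP => /eqP E; apply: Hn; exists x; rewrite // rmorphM.
split=> //.
- move=> _ [y [z [Fy Fz ->]]]; exists (io y), (io z).
  by rewrite rmorphD rmorphM; split=> //; apply: FB.
- have sub x : adjoins F B t m x -> span io (quad_ext (adjoins_field F t m) s) b x.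
    move=> /Bb[c Fc ->]; exists c => // i.
    by apply: quad_ext_base => //; apply: subfield_subring.
  move=> _ [y [z [By Bz ->]]]; apply: (spanD sQ); first exact: sub.
  rewrite -ioC; apply: (spanZ sQ); last exact: sub.
  by apply: quad_ext_gen; apply: subfield_subring.
Qed.

End IteratedAdjunction.

(** * Isotropy of diagonal forms and its specialisation *)

Section DiagonalForms.
Variable K : fieldType.
Implicit Types (F : K -> Prop) (rho psi : seq K).

Definition coefs_in F rho := forall i, F rho`_i.
Definition nonzero_coefs rho := forall i, (i < size rho)%N -> rho`_i != 0.

Definition form_value rho (x : nat -> K) := \sum_(i < size rho) rho`_i * x i ^+ 2.

Definition isotropic F rho := exists x : nat -> K,
  [/\ forall i, F (x i), exists2 i, (i < size rho)%N & x i != 0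
    & form_value rho x = 0].

Lemma form_value_cons a rho x :
  form_value (a :: rho) x = a * x 0%N ^+ 2 + form_value rho (fun i => x i.+1).
Proof. by rewrite /form_value big_ord_recl. Qed.

Lemma isotropic_cons F a rho : subfield F -> isotropic F rho -> isotropic F (a :: rho).
Proof.
move=> sF [x [Fx [i lt nx] E]]; exists (fun j => if j is k.+1 then x k else 0); split.
- by case=> [|k] //; exact: subring0 (subfield_subring sF).
- by exists i.+1.
- by rewrite form_value_cons expr0n mulr0 add0r.
Qed.

Lemma isotropic_mono F F' rho : (forall a, F a -> F' a) ->
  isotropic F rho -> isotropic F' rho.
Proof. by move=> FF [x [Fx nx E]]; exists x; split=> // i; apply: FF. Qed.

Hypothesis two : 2%:R != 0 :> K.

(* If [x] is a zero and [x k != 0], the value at [lam * x + e_k] is affine and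
   nonconstant in [lam]. *)
Lemma isotropic_value F rho a : subfield F -> coefs_in F rho -> nonzero_coefs rho ->
  isotropic F rho -> F a -> exists2 x, forall i, F (x i) & form_value rho x = a.
Proof.
move=> sF Frho nrho [x [Fx [k lt nx] E]] Fa.
have rF := subfield_subring sF.
pose lam := (a - rho`_k) / (2%:R * rho`_k * x k).
have Flam : F lam.
  apply: (subringM rF); first exact: subringB.
  apply: subfieldV => //; apply: (subringM rF) => //; apply: (subringM rF) => //.
  by rewrite mulr2n; apply: (subringD rF); apply: subring1.
exists (fun i => lam * x i + (i == k)%:R).
  move=> i; apply: (subringD rF); first exact: subringM.
  by case: eqP => _; [exact: subring1|exact: subring0].
have -> : form_value rho (fun i => lam * x i + (i == k)%:R) =
    lam ^+ 2 * form_value rho x + \sum_(i < size rho) (i == k :> nat)%:R *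
      (rho`_k * (2%:R * lam * x k + 1)).
  rewrite /form_value mulr_sumr -big_split /=; apply: eq_bigr => i _.
  by have [->|_] := eqVneq (i : nat) k; rewrite /= ?mulr1n ?mulr0n; ring.
rewrite E mulr0 add0r (bigD1 (Ordinal lt)) //= eqxx mul1r big1 ?addr0; last first.
  by move=> i; rewrite -val_eqE /= => /negbTE->; rewrite mul0r.
rewrite /lam; field; by rewrite two nrho // nx.
Qed.

(** A zero with leading coordinate 0 makes [rho] isotropic, so [rho] represents [- a] and the
    leading coordinate can be taken to be 1. It later supplies the nonzero [c] of
    [function_field_anisotropic]. *)
Lemma isotropic_leading F a rho : subfield F -> F a -> a != 0 -> coefs_in F rho ->
  nonzero_coefs rho -> isotropic F (a :: rho) ->
  exists x, [/\ forall i, F (x i), x 0%N != 0 & form_value (a :: rho) x = 0].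
Proof.
move=> sF Fa na Frho nrho [x [Fx [i lt nx] E]].
have rF := subfield_subring sF.
have [x0|] := eqVneq (x 0%N) 0; last by exists x.
have iso : isotropic F rho.
  exists (fun j => x j.+1); split=> //.
    by case: i lt nx => [|i] lt; [rewrite x0 eqxx|exists i].
  by move: E; rewrite form_value_cons x0 expr0n mulr0 add0r.
have [y Fy Ey] := isotropic_value sF Frho nrho iso (subringN rF Fa).
exists (fun j => if j is k.+1 then y k else 1); split.
- by case=> [|k] //; apply: subring1.
- exact: oner_neq0.
- by rewrite form_value_cons Ey expr1n mulr1 subrr.
Qed.

Definition polar_value rho (x y : nat -> K) := \sum_(i < size rho) rho`_i * x i * y i.

(* When [delta] is not a square, this is isotropy over [F (sqrt delta)]. *)
Definition sqrt_isotropic F rho delta := exists x y : nat -> K,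
  [/\ forall i, F (x i) /\ F (y i),
      exists2 i, (i < size rho)%N & (x i != 0) || (y i != 0),
      form_value rho x + delta * form_value rho y = 0
    & polar_value rho x y = 0].

Lemma form_valueD rho x y c : form_value rho (fun i => x i + c * y i) =
  form_value rho x + c ^+ 2 * form_value rho y + 2%:R * c * polar_value rho x y.
Proof.
rewrite /form_value /polar_value !mulr_sumr -!big_split /=; apply: eq_bigr => i _.
by ring.
Qed.

(** For a zero [p + q * s], a nonzero polar value of [p] and [q] would express [s] by elements of
    [F]. If [s] is in [F], the zero itself serves, with second vector 0. *)
Lemma sqrt_isotropic_quad_ext F rho s : subfield F -> coefs_in F rho ->
  F (s * s) -> isotropic (quad_ext F s) rho -> sqrt_isotropic F rho (s * s).
Proof.
move=> sF Frho Fs [x [Fx [i lt nx] E]].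
have rF := subfield_subring sF.
have [Fs1|nFs] := pselect (F s).
  exists x, (fun=> 0); split.
  - move=> j; split; last exact: subring0.
    by have [y [z [Fy Fz ->]]] := Fx j; apply: (subringD rF) => //; apply: subringM.
  - by exists i => //; rewrite nx.
  - by rewrite E /form_value big1 ?mulr0 ?addr0 // => j _; rewrite expr0n mulr0.
  - by rewrite /polar_value big1 // => j _; rewrite mulr0.
have /choice[p /choice[q H]] : forall j, exists y z, [/\ F y, F z & x j = y + z * s] by [].
have Ex : form_value rho x = form_value rho p + s ^+ 2 * form_value rho q
      + 2%:R * s * polar_value rho p q.
  by rewrite -form_valueD; apply: eq_bigr => j _; case: (H j) => _ _ ->; rewrite [s * _]mulrC.
have Fv y : (forall j, F (y j)) -> F (form_value rho y).
  by move=> Fy; apply: (subring_sum rF) => j _; apply: (subringM rF) => //; apply: subringX.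
have Fp j : F (p j) by case: (H j).
have Fq j : F (q j) by case: (H j).
have Fpq : F (polar_value rho p q).
  by apply: (subring_sum rF) => j _; apply: (subringM rF) => //; apply: (subringM rF).
have pq0 : polar_value rho p q = 0.
  apply: contrapT => /eqP npq; apply: nFs.
  have -> : s = - (form_value rho p + s * s * form_value rho q) / (2%:R * polar_value rho p q).
    move: Ex; rewrite E => Ex; apply: (mulIf (x := 2%:R * polar_value rho p q)).
      by rewrite mulf_neq0.
    rewrite mulfVK ?mulf_neq0 //; apply/eqP; rewrite -addr_eq0 Ex; apply/eqP; ring.
  apply: (subringM rF).
    apply: (subringN rF); apply: (subringD rF); first exact: Fv.
    by apply: (subringM rF) => //; exact: Fv.
  apply: subfieldV => //; apply: (subringM rF) => //.
  by rewrite mulr2n; apply: (subringD rF); apply: subring1.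
exists p, q; split=> //.
- exists i => //; apply: contraNT nx; rewrite negb_or !negbK => /andP[/eqP p0 /eqP q0].
  by case: (H i) => _ _ ->; rewrite p0 q0 mul0r addr0.
- by rewrite -expr2 -[RHS]E Ex pq0 mulr0 addr0.
Qed.

(** Both [x + c y] and [x - c y] have value 0, and they do not both vanish at [i], since 2 and [c]
    are invertible. *)
Lemma sqrt_isotropic_sqr F rho c : subfield F -> F c -> c != 0 ->
  sqrt_isotropic F rho (c ^+ 2) -> isotropic F rho.
Proof.
move=> sF Fc nc [x [y [Fxy [i lt nxy] E E0]]]; have rF := subfield_subring sF.
have plus : form_value rho (fun i => x i + c * y i) = 0.
  by rewrite form_valueD E E0 mulr0 addr0.
have minus : form_value rho (fun i => x i + - c * y i) = 0.
  by rewrite form_valueD sqrrN E E0 mulr0 addr0.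
have [xy|nxy1] := eqVneq (x i + c * y i) 0; last first.
  exists (fun i => x i + c * y i); split=> //; last by exists i.
  by move=> j; have [Fx Fy] := Fxy j; apply: (subringD rF) => //; apply: subringM.
exists (fun i => x i + - c * y i); split=> //.
  move=> j; have [Fx Fy] := Fxy j; apply: (subringD rF) => //; apply: subringM => //.
  exact: subringN.
exists i => //; apply: contraTneq nxy => xy'.
have x0 : x i = 0.
  by apply: (mulfI two); rewrite mulr0 -[RHS]addr0 -{1}xy -xy'; ring.
move: xy; rewrite x0 add0r eqxx => /eqP; rewrite mulf_eq0 (negbTE nc) /= => ->.
by [].
Qed.

(** The quotient is written out from [X^i - e^i], which shows that its coefficients lie in [F]. *)
Lemma poly_in_factor F p e : subfield F -> poly_in F p -> F e -> p.[e] = 0 ->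
  exists2 q, poly_in F q & p = ('X - e%:P) * q.
Proof.
move=> sF Fp Fe pe; have rF := subfield_subring sF; have pF := poly_in_subring rF.
exists (\sum_(i < size p) (p`_i)%:P * \sum_(j < i) 'X^(i.-1 - j) * e%:P ^+ j).
  apply: (subring_sum pF) => i _; apply: (subringM pF); first exact: poly_inC.
  apply: (subring_sum pF) => j _; apply: (subringM pF); apply: (subringX pF).
    exact: poly_inX.
  exact: poly_inC.
rewrite mulr_sumr.
transitivity (\sum_(i < size p) p`_i *: 'X^i - (\sum_(i < size p) p`_i * e ^+ i)%:P).
  by rewrite -poly_def coefK -horner_coef pe subr0.
rewrite rmorph_sum /= -sumrB; apply: eq_bigr => i _.
by rewrite mulrCA -subrXX polyCM polyC_exp mulrBr -mul_polyC.
Qed.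

Lemma poly_in_primitive F (S : finType) (p : S -> {poly K}) e : subfield F -> F e ->
  (forall i, poly_in F (p i)) -> (exists i, p i != 0) ->
  exists k (q : S -> {poly K}), [/\ forall i, p i = ('X - e%:P) ^+ k * q i,
    forall i, poly_in F (q i) & exists i, (q i).[e] != 0].
Proof.
move=> sF Fe; have [n] := ubnP (\sum_i size (p i)).
elim: n => // n IH in p *; rewrite ltnS => sp Fp [i ni].
have [[j nj]|Hn] := pselect (exists j, (p j).[e] != 0).
  by exists 0%N, p; split=> // [k|]; [rewrite mul1r|exists j].
have /choice[q Hq] : forall j, exists q, poly_in F q /\ p j = ('X - e%:P) * q.
  move=> j; have [|q Fq E] := poly_in_factor sF (Fp j) Fe; last by exists q.
  by apply/eqP; apply: contrapT => /negP H; apply: Hn; exists j.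
have sq j : size (q j) = (size (p j)).-1.
  have [q0|nq] := eqVneq (q j) 0.
    by case: (Hq j) => _ ->; rewrite q0 mulr0 size_poly0.
  by case: (Hq j) => _ ->; rewrite size_mul ?polyXsubC_eq0 // size_XsubC.
have [|j||k [r [Hr Fr nr]]] := IH q _ _ _.
- apply: leq_trans sp; rewrite (bigD1 i) //= [X in (_ < X)%N](bigD1 i) //=.
  rewrite sq -addSn prednK ?size_poly_gt0 // leq_add2l.
  by apply: leq_sum => j _; rewrite sq leq_pred.
- by case: (Hq j).
- by exists i; apply: contraNneq ni => q0; case: (Hq i) => _ ->; rewrite q0 mulr0.
- exists k.+1, r; split=> // j; case: (Hq j) => _ ->.
  by rewrite Hr exprS mulrA.
Qed.

(** Substituting [e] for [t] could meet a pole or produce the zero vector. Hence denominators are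
    cleared and the common power of [X - e] is divided out before evaluation. *)
Lemma sqrt_isotropic_specialize F rho t delta d e : subfield F ->
  transcendental F t -> coefs_in F rho -> F delta -> F d -> F e ->
  sqrt_isotropic (adjoin_field F t) rho (delta + d * t ^+ 2) ->
  sqrt_isotropic F rho (delta + d * e ^+ 2).
Proof.
move=> sF Ht Frho Fdelta Fd Fe [x [y [Fxy [i lt nxy] E E0]]].
have rF := subfield_subring sF; have pF := poly_in_subring rF.
set n := size rho in lt *.
(* Both vectors share one denominator and one power of [X - e]: [true] marks the coordinates of [x],
   [false] those of [y]. *)
pose z (k : bool * 'I_n) := if k.1 then x k.2 else y k.2.
have [|c [Fc nc] Hc] := @common_denominator K K idfun (fun _ _ => mulrC _ _) F F t sF rF
    (fun _ h => h) _ z.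
  by move=> [[] k]; case: (Fxy k).
have /choice[p Hp] : forall k, exists p, poly_in F p /\ c.[t] * z k = p.[t].
  by move=> k; have [p ? ?] := Hc k; exists p.
have Fp k : poly_in F (p k) by case: (Hp k).
have [|k [q [Hq Fq [j nj]]]] := poly_in_primitive sF Fe Fp.
  have [nx|ny] := orP nxy.
    exists (true, Ordinal lt); apply: contraNneq nx => p0.
    by have [_ ] := Hp (true, Ordinal lt); rewrite p0 horner0 => /eqP; rewrite mulf_eq0 (negbTE nc).
  exists (false, Ordinal lt); apply: contraNneq ny => p0.
  by have [_ ] := Hp (false, Ordinal lt); rewrite p0 horner0 => /eqP; rewrite mulf_eq0 (negbTE nc).
(* [N (V h)] and [V h true false] are the two relations of [sqrt_isotropic] with an indeterminate in
   place of [t]. They hold as polynomial identities because [t] is transcendental. *)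
pose N (h : bool -> bool -> {poly K}) := h true true + (delta%:P + d%:P * 'X^2) * h false false.
pose V (h : bool * 'I_n -> {poly K}) (u v : bool) :=
  \sum_(i < n) (rho`_i)%:P * h (u, i) * h (v, i).
have FV h u v : (forall k, poly_in F (h k)) -> poly_in F (V h u v).
  move=> Fh; apply: (subring_sum pF) => k' _; apply: (subringM pF) => //.
  by apply: (subringM pF) => //; apply: poly_inC.
have FdX : poly_in F (delta%:P + d%:P * 'X^2).
  apply: (subringD pF); first exact: poly_inC.
  apply: (subringM pF); first exact: poly_inC.
  by apply: (subringX pF); apply: poly_inX.
have Vt u v : (V p u v).[t] = c.[t] ^+ 2 * \sum_(i < n) rho`_i * z (u, i) * z (v, i).
  rewrite horner_sum mulr_sumr; apply: eq_bigr => k' _.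
  by rewrite !hornerM hornerC -(Hp (u, k')).2 -(Hp (v, k')).2; ring.
have Vpq u v : V p u v = ('X - e%:P) ^+ (k + k) * V q u v.
  rewrite /V mulr_sumr; apply: eq_bigr => k' _; rewrite !Hq exprD; ring.
have cancelX (P : {poly K}) : ('X - e%:P) ^+ (k + k) * P = 0 -> P = 0.
  by move/eqP; rewrite mulf_eq0 expf_eq0 polyXsubC_eq0 andbF => /eqP.
have P1 : N (V q) = 0.
  apply: cancelX; have -> : ('X - e%:P) ^+ (k + k) * N (V q) = N (V p) by rewrite /N !Vpq; ring.
  apply: Ht.
    by apply: (subringD pF); [exact: FV|apply: (subringM pF) => //; exact: FV].
  have Vx : (V p true true).[t] = c.[t] ^+ 2 * form_value rho x.
    by rewrite Vt; congr (_ * _); apply: eq_bigr => k' _; rewrite /z /= expr2 mulrA.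
  have Vy : (V p false false).[t] = c.[t] ^+ 2 * form_value rho y.
    by rewrite Vt; congr (_ * _); apply: eq_bigr => k' _; rewrite /z /= expr2 mulrA.
  rewrite /N hornerD hornerM Vx Vy -[RHS](mulr0 (c.[t] ^+ 2)) -E.
  have -> : (delta%:P + d%:P * 'X^2).[t] = delta + d * t ^+ 2 by rewrite !hornerE.
  by ring.
have P2 : V q true false = 0.
  apply: cancelX; rewrite -Vpq; apply: Ht; first exact: FV.
  by rewrite Vt -[X in _ * X]/(polar_value rho x y) E0 mulr0.
pose w u k' := if insub k' is Some l then (q (u, l)).[e] else 0.
have wE u (l : 'I_n) : w u l = (q (u, l)).[e] by rewrite /w valK.
have Vq u v : (V q u v).[e] = \sum_(i < n) rho`_i * w u i * w v i.
  by rewrite horner_sum; apply: eq_bigr => l _; rewrite !hornerM hornerC !wE.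
exists (w true), (w false); split.
- have Fw u k' : F (w u k').
    by rewrite /w; case: insubP => [l _ _|_]; [exact: poly_in_horner|exact: subring0].
  by move=> k'.
- case: j nj => [u l] nl; exists l => //; rewrite !wE; case: u nl => -> //.
  by rewrite orbT.
- have := congr1 (fun P : {poly K} => P.[e]) P1; rewrite /N !hornerE !Vq => <-.
  by congr (_ + _ * _); apply: eq_bigr => l _; rewrite expr2 mulrA.
- by have := congr1 (fun P : {poly K} => P.[e]) P2; rewrite Vq horner0.
Qed.

(** The last variable is specialised first; [c] collects the terms already evaluated. *)
Lemma sqrt_isotropic_specializes F rho t (d e : nat -> K) m c : subfield F ->
  independent_transcendentals F t m -> coefs_in F rho -> F c ->
  (forall i, F (d i)) -> (forall i, F (e i)) ->
  sqrt_isotropic (adjoins_field F t m) rho (\sum_(i < m) d i * t i ^+ 2 + c) ->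
  sqrt_isotropic F rho (\sum_(i < m) d i * e i ^+ 2 + c).
Proof.
move=> sF + Frho + Fd Fe; elim: m c => [|m IH] c Ht Fc; first by rewrite !big_ord0.
have rF := subfield_subring sF; have sFm := adjoins_subfield t m sF.
have -> : \sum_(i < m.+1) d i * t i ^+ 2 + c = \sum_(i < m) d i * t i ^+ 2 + c + d m * t m ^+ 2.
  by rewrite big_ord_recr /=; ring.
have -> : \sum_(i < m.+1) d i * e i ^+ 2 + c = \sum_(i < m) d i * e i ^+ 2 + (c + d m * e m ^+ 2).
  by rewrite big_ord_recr /=; ring.
move=> H.
have {}H : sqrt_isotropic (adjoins_field F t m) rho
    (\sum_(i < m) d i * t i ^+ 2 + c + d m * e m ^+ 2).
  apply: (sqrt_isotropic_specialize sFm _ _ _ _ _ H).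
  - exact: Ht.
  - by move=> i; apply: adjoins_base.
  - apply: (subringD (subfield_subring sFm)); last exact: adjoins_base.
    exact: adjoins_form.
  - exact: adjoins_base.
  - exact: adjoins_base.
apply: IH.
- exact: independent_transcendentals_pred Ht.
- by apply: (subringD rF) => //; apply: (subringM rF) => //; apply: subringX.
- by rewrite addrA.
Qed.

(* If the quadric has a rational point with [c != 0], its function field is
   contained in an iterated Laurent series field; here only the specialisation
   at that point is needed. *)
Lemma function_field_anisotropic F psi t (d e : nat -> K) m s c : subfield F ->
  independent_transcendentals F t m -> coefs_in F psi ->
  (forall i, F (d i)) -> (forall i, F (e i)) -> F c -> c != 0 ->
  \sum_(i < m) d i * e i ^+ 2 = c ^+ 2 -> s * s = \sum_(i < m) d i * t i ^+ 2 ->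
  isotropic (quad_ext (adjoins_field F t m) s) psi -> isotropic F psi.
Proof.
move=> sF Ht Fpsi Fd Fe Fc nc Ec Es.
have sFm := adjoins_subfield t m sF.
move=> H; have {}H : sqrt_isotropic (adjoins_field F t m) psi (s * s).
  apply: (sqrt_isotropic_quad_ext sFm _ _ H); first by move=> i; apply: adjoins_base.
  by rewrite Es; apply: adjoins_form.
apply: (@sqrt_isotropic_sqr F psi c) => //; rewrite -Ec -[X in sqrt_isotropic _ _ X]addr0.
apply: (sqrt_isotropic_specializes (t := t)) => //; last by rewrite addr0 -Es.
exact: subring0 (subfield_subring sF).
Qed.

End DiagonalForms.

(** * Clifford systems in division algebras *)

Section CliffordSystems.
Variables (K : fieldType) (R : nzRingType) (io : {rmorphism K -> R}).
Hypothesis ioC : forall a x, io a * x = x * io a.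
Hypothesis two : 2%:R != 0 :> K.

Lemma anticommuting_sum_sqr (v : nat -> R) (y : nat -> K) k : anticommuting v k ->
  (\sum_(i < k) io (y i) * v i) * (\sum_(i < k) io (y i) * v i) =
  \sum_(i < k) io (y i ^+ 2) * (v i * v i).
Proof.
move=> av; have : (k <= k)%N by [].
elim: {-2}k => [|n IH] nk; first by rewrite !big_ord0 mulr0.
rewrite !big_ord_recr /= mulrDl !mulrDr IH ?(ltnW nk) //.
set S := \sum_(i < n) io (y i) * v i.
have Sv : S * v n = - (v n * S).
  rewrite mulr_suml mulr_sumr -sumrN; apply: eq_bigr => i _.
  rewrite -mulrA av ?(ltn_trans (ltn_ord i) nk) ?ltn_eqF //.
  by rewrite mulrN !mulrA ioC.
rewrite -addrA; congr (_ + _).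
have -> : S * (io (y n) * v n) = - (io (y n) * v n * S).
  by rewrite mulrA -ioC -mulrA Sv mulrN mulrA.
rewrite addrA addNr add0r.
by rewrite expr2 rmorphM -!mulrA (mulrA (v n) (io _)) -ioC !mulrA.
Qed.

(* In the even Clifford algebra of [a0 :: rho], with orthogonal basis [e_i], the
   element [e_0 * e_i] squares to [- (a0 * a_i)]. *)
Definition clifford_squares a0 (rho : seq K) := [seq - (a0 * a) | a <- rho].

(* From a zero [x] one gets [E = \sum_i x_(i+1) v_i] with [E^2 = (a0 x_0)^2],
   so that [E] is a scalar in the division algebra [B]. *)
Lemma isotropic_division (T : finType) (b : T -> R) (F : K -> Prop) (B : R -> Prop)
    a0 rho v :
  division_algebra io b F B -> coefs_in F (a0 :: rho) -> nonzero_coefs (a0 :: rho) ->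
  (forall i, (i < size rho)%N -> B (v i)) ->
  (forall i, (i < size rho)%N -> v i * v i = io (clifford_squares a0 rho)`_i) ->
  anticommuting v (size rho) ->
  isotropic F (a0 :: rho) ->
  size rho = 1%N /\ exists2 c, F c & v 0%N = io c.
Proof.
move=> [sF sB FB _ dB] Frho nrho Bv dv av [x [Fx [i0 lti0 nx] Ex]].
have rF := subfield_subring sF.
have na0 : a0 != 0 by apply: (nrho 0%N).
have Fa0 : F a0 by apply: (Frho 0%N).
have nr i : (i < size rho)%N -> rho`_i != 0 by move=> lt; apply: (nrho i.+1).
have sqE i : (i < size rho)%N -> (clifford_squares a0 rho)`_i = - (a0 * rho`_i).
  by move=> lt; rewrite (nth_map 0).
have nsq i : (i < size rho)%N -> (clifford_squares a0 rho)`_i != 0.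
  by move=> lt; rewrite sqE // oppr_eq0 mulf_neq0 // nr.
set k := size rho in Bv dv av nr sqE nsq lti0 *.
pose E := \sum_(i < k) io (x i.+1) * v i.
have EE : E * E = io (a0 * x 0%N) * io (a0 * x 0%N).
  rewrite /E (anticommuting_sum_sqr (fun i => x i.+1) av) -rmorphM.
  under eq_bigr => i _ do rewrite dv // sqE // -rmorphM.
  rewrite -rmorph_sum; congr (io _).
  have -> : \sum_(i < k) x i.+1 ^+ 2 * - (a0 * rho`_i) =
     - a0 * form_value rho (fun i => x i.+1).
    by rewrite /form_value mulr_sumr; apply: eq_bigr => i _; ring.
  move/eqP: Ex; rewrite form_value_cons addrC addr_eq0 => /eqP->; ring.
have BE : B E.
  by apply: (subring_sum sB) => i _; apply: (subringM sB); [exact: FB|exact: Bv].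
have [c [Fc c2 Ec]] : exists c, [/\ F c, c ^+ 2 = (a0 * x 0%N) ^+ 2 & E = io c].
  have F0 : F (a0 * x 0%N) by apply: subringM.
  have [Ec|nE] := eqVneq (E - io (a0 * x 0%N)) 0.
    by exists (a0 * x 0%N); split=> //; apply/eqP; rewrite -subr_eq0 Ec.
  exists (- (a0 * x 0%N)); split; [exact: subringN|by rewrite sqrrN|].
  apply/eqP; rewrite rmorphN -addr_eq0; apply/eqP.
  apply: (division_regular dB _ nE); first by apply: (subringB sB) => //; apply: FB.
  by rewrite mulrBl !mulrDr EE (ioC _ E) [in X in _ - X]addrC subrr.
(* As [E] is the scalar [c], its anticommutator with [v i] is [2 c v_i]; expanding [E] leaves only
   the term [2 x_(i+1) v_i^2]. *)
have key i : (i < k)%N -> io (x i.+1 * (clifford_squares a0 rho)`_i) = io c * v i.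
  move=> lt; apply/eqP; rewrite -subr_eq0; apply/eqP.
  apply: (io_regular (io := io) two); rewrite mulrBr rmorph_nat.
  have : v i * E + E * v i = 2%:R * (io c * v i) by rewrite Ec -ioC mulr_natl mulr2n.
  move=> <-; apply/eqP; rewrite subr_eq0; apply/eqP; rewrite mulr_sumr mulr_suml -big_split /=.
  rewrite (bigD1 (Ordinal lt)) //= [X in _ + X]big1 ?addr0 => [|j ij].
    by rewrite (mulrA (v i)) -ioC -!mulrA dv // -rmorphM mulr_natl mulr2n.
  rewrite (mulrA (v i)) -ioC -!mulrA -mulrDr av ?addNr ?mulr0 //.
  by apply: contraNneq ij => E'; apply/eqP/val_inj.
have [c0|nc] := eqVneq c 0.
  have x0 : x 0%N = 0.
    by move/esym/eqP: c2; rewrite c0 expr0n sqrf_eq0 mulf_eq0 (negbTE na0) => /eqP.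
  case: i0 lti0 nx => [_|i lt]; first by rewrite x0 eqxx.
  have := key i lt; rewrite c0 rmorph0 mul0r => /eqP.
  by rewrite fmorph_eq0 mulf_eq0 (negbTE (nsq i lt)) orbF => ->.
have scal i : (i < k)%N -> v i = io (c^-1 * (x i.+1 * (clifford_squares a0 rho)`_i)).
  by move=> lt; rewrite rmorphM key // mulrA -rmorphM mulVf // rmorph1 mul1r.
have Fsc i : (i < k)%N -> F (c^-1 * (x i.+1 * (clifford_squares a0 rho)`_i)).
  move=> lt; apply: (subringM rF); first exact: subfieldV.
  apply: (subringM rF) => //; rewrite sqE //; apply: (subringN rF).
  by apply: (subringM rF) => //; apply: (Frho i.+1).
case: (ltngtP k 1%N) => [|k2|k1].
- rewrite ltnS leqn0 => /eqP k0; move: Ec; rewrite /E k0 big_ord0 => /esym/eqP.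
  by rewrite fmorph_eq0 (negbTE nc).
- have := av 0%N 1%N (ltnW k2) k2 isT.
  rewrite (scal 0%N (ltnW k2)) ioC -(scal 0%N (ltnW k2)) => /eqP.
  rewrite -addr_eq0 -mulr2n -mulr_natl -(rmorph_nat io) => /eqP /(io_regular two) v10.
  have := congr1 (fun z => v 1%N * z * v 0%N) v10.
  rewrite mulrA dv // mulr0 mul0r -mulrA dv ?(ltnW k2) // -rmorphM => /eqP.
  by rewrite fmorph_eq0 mulf_eq0 !(negbTE (nsq _ _)) // ltnW.
- have lt0 : (0 < k)%N by rewrite k1.
  by split=> //; apply: ex_intro2 (Fsc _ lt0) (scal _ lt0).
Qed.

Lemma clifford_system_take B m l : clifford_system io B l -> clifford_system io B (take m l).
Proof.
move=> [z [Bz dz az]].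
have sub i : (i < size (take m l))%N -> (i < size l)%N.
  by rewrite size_take_min leq_min => /andP[].
have sub' i : (i < size (take m l))%N -> (i < m)%N.
  by rewrite size_take_min leq_min => /andP[].
exists z; split=> [i lt|i lt|i j lti ltj].
- exact/Bz/sub.
- by rewrite nth_take ?sub' //; apply/dz/sub.
- exact/az/sub/ltj/sub.
Qed.

(** For an even number of generators the relations alone force independent monomials. This is what
    keeps [D] division over the function fields of forms of dimension above [r + 1]. *)
Lemma clifford_system_card (T : finType) (b : T -> R) F B l :
  subfield F -> subring B -> (forall x, B x -> span io F b x) ->
  clifford_system io B l -> ~~ odd (size l) -> nonzero_coefs l ->
  (2 ^ size l <= #|T|)%N.
Proof.
move=> sF sB Bb [z [Bz dz az]] el nl; rewrite -card_monomials.
have bz (f : {ffun 'I_(size l) -> bool}) : span io F b (monomials z f).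
  by apply: Bb; exact: (monomial_in (bits f) sB Bz).
apply: (span_independent_card sF bz).
exact: (monomials_independent ioC two el az dz nl).
Qed.

Definition bits_xor r (f g : {ffun 'I_r -> bool}) : {ffun 'I_r -> bool} :=
  [ffun i => f i (+) g i].

(** The product of the Clifford algebra on coefficient functions. It depends on [d] alone, so
    identities between elements pass from one family of generators to any other with the same
    squares. *)
Definition monomial_conv r (d : nat -> K) (e c : {ffun 'I_r -> bool} -> K)
    (h : {ffun 'I_r -> bool}) : K :=
  \sum_g \sum_(f | bits_xor g f == h)
     e g * c f * monomial_coef d r (bits g) (bits f).

Lemma monomial_sumM w d r (e c : {ffun 'I_r -> bool} -> K) :
  anticommuting w r -> (forall i, (i < r)%N -> w i * w i = io (d i)) ->
  (\sum_g io (e g) * monomials w g) * (\sum_f io (c f) * monomials w f) =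
  \sum_h io (monomial_conv d e c h) * monomials w h.
Proof.
move=> aw dw; rewrite /monomial_conv mulr_suml.
under [RHS]eq_bigr => h _ do rewrite rmorph_sum mulr_suml.
rewrite [RHS]exchange_big /=; apply: eq_bigr => g _; rewrite mulr_sumr.
under [RHS]eq_bigr => h _ do rewrite rmorph_sum mulr_suml.
rewrite (exchange_big_dep predT) //=; apply: eq_bigr => f _.
rewrite (big_pred1 (bits_xor g f)); last by move=> h; rewrite eq_sym.
rewrite -mulrA (mulrA (monomials w g)) -ioC -mulrA (monomialM ioC _ _ aw dw).
rewrite !rmorphM !mulrA; congr (_ * _); apply: eq_monomial => i lt.
by rewrite (bitsE (bits_xor g f) (Ordinal lt)) ffunE -!(bitsE _ (Ordinal lt)).
Qed.

Section Universal.
Variables (u : nat -> R) (d : nat -> K) (r : nat).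
Hypotheses (au : anticommuting u r)
           (du : forall i, (i < r)%N -> u i * u i = io (d i))
           (iu : independent io (@monomials R u r)).

Let one_bits : {ffun 'I_r -> bool} := [ffun=> false].

Lemma monomial_one (w : nat -> R) :
  1 = \sum_(h : {ffun 'I_r -> bool}) io (h == one_bits)%:R * monomials w h.
Proof.
rewrite (bigD1 one_bits) //= eqxx rmorph1 mul1r big1 => [|h /negbTE->].
  rewrite addr0 -(monomial1 w r); apply: eq_monomial => i lt.
  by rewrite (bitsE _ (Ordinal lt)) ffunE.
by rewrite rmorph0 mul0r.
Qed.

(* The division algebra generated by [u] is simple, hence maps injectively to
   any algebra containing elements with the same relations. *)
Lemma monomials_independent_over F w (c : {ffun 'I_r -> bool} -> K) :
  division (span io F (@monomials R u r)) -> anticommuting w r ->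
  (forall i, (i < r)%N -> w i * w i = io (d i)) ->
  (forall f, F (c f)) -> \sum_f io (c f) * monomials w f = 0 -> forall f, c f = 0.
Proof.
move=> dD aw dw Fc cw.
have [cu|ncu] := eqVneq (\sum_f io (c f) * monomials u f) 0; first exact: iu.
(* The coefficients [e] of an inverse, computed with [u], also give an inverse of the sum in [w];
   but that sum is 0. *)
have [|_ [e Fe ->] E] := dD _ _ ncu; first by exists c.
rewrite (monomial_sumM _ _ au du) in E.
have conv h : monomial_conv d e c h = (h == one_bits)%:R.
  apply/eqP; rewrite -subr_eq0; apply/eqP; move: h; apply: iu.
  under eq_bigr => h _ do rewrite rmorphB mulrBl.
  by rewrite sumrB E -monomial_one subrr.
have := monomial_sumM e c aw dw; rewrite cw mulr0.
under eq_bigr => h _ do rewrite conv.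
by rewrite -monomial_one => /esym/eqP; rewrite oner_eq0.
Qed.

Lemma span_monomials_scalar F a : subfield F ->
  span io F (@monomials R u r) (io a) -> F a.
Proof.
move=> sF [c Fc E].
suff : c one_bits - a = 0 by move/eqP; rewrite subr_eq0 => /eqP <-.
have -> : c one_bits - a = c one_bits - a * (one_bits == one_bits)%:R by rewrite eqxx mulr1.
apply: (iu (c := fun h => c h - a * (h == one_bits)%:R)).
under eq_bigr => h _ do rewrite rmorphB mulrBl rmorphM -mulrA.
by rewrite sumrB -E -mulr_sumr -monomial_one mulr1 subrr.
Qed.

Variables (F : K -> Prop).
Hypotheses (Fd : forall i, F (d i))
  (dD : division_algebra io (@monomials R u r) F (span io F (@monomials R u r))).

Let D := span io F (@monomials R u r).
Let sF : subfield F. Proof. by case: dD. Qed.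

(* A subalgebra of [D] generated by fewer elements is too small to contain a
   copy of [D], so it remains division over the function field of the form
   attached to [D]. *)
Lemma function_field_isotropic_descent a0 rho t s :
  coefs_in F (a0 :: rho) -> nonzero_coefs (a0 :: rho) -> (size rho < r)%N ->
  clifford_system io D (clifford_squares a0 rho) ->
  independent_transcendentals F t r -> s * s = \sum_(i < r) d i * t i ^+ 2 ->
  isotropic (quad_ext (adjoins_field F t r) s) (a0 :: rho) -> isotropic F (a0 :: rho).
Proof.
move=> Frho nrho srho [v [Dv dv av]] Ht ss iso.
have [_ sD FD _ divD] := dD; have rF := subfield_subring sF.
rewrite size_map in Dv dv av.
set k := size rho in srho Dv dv av.
(* [A] is the image in [D] of the even Clifford algebra of [a0 :: rho]. Spanned by [2 ^ k] elements
   with [k < r], it has no room for a copy of [D]. *)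
pose A := span io F (@monomials R v k).
have Fsq i : F (clifford_squares a0 rho)`_i.
  have [lt|ge] := ltnP i (size rho); last first.
    by rewrite nth_default ?size_map //; apply: subring0.
  rewrite (nth_map 0) //; apply: (subringN rF); apply: (subringM rF).
    exact: (Frho 0%N).
  exact: (Frho i.+1).
have sA : subring A by apply: (monomial_span_subring ioC sF av dv).
have AD x : A x -> D x.
  move=> [c Fc ->]; apply: (subring_sum sD) => f _; apply: (subringM sD); first exact: FD.
  by apply: monomial_in.
have dA : division_algebra io (@monomials R u r) F A.
  split=> //; first exact: monomial_span_scalar.
  apply: (span_division ioC sF sA (b := @monomials R v k)) => //.
    exact: monomial_span_scalar.
  by move=> x y Ax Ay nx; apply: (division_regular divD); [exact: AD|].
have Av i : (i < k)%N -> A (v i).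
  by move=> lt; rewrite -(monomial_gen v lt); apply: span_monomial.
have [[w]|dM] := function_field_division ioC iu dA Ht Fd ss.
  rewrite size_mkseq => -[Aw dw aw].
  have {}dw i : (i < r)%N -> w i * w i = io (d i).
    by move=> lt; rewrite dw // nth_mkseq.
  have Aw' (f : {ffun 'I_r -> bool}) : span io F (@monomials R v k) (monomials w f).
    exact: (monomial_in (bits f) sA Aw).
  have [|c [Fc [f nc] cw]] := span_dependence sF Aw'.
    by rewrite !card_monomials ltn_exp2l.
  by move: nc; rewrite (monomials_independent_over divD aw dw Fc cw) eqxx.
have sF1 := adjoins_subfield t r sF.
have inM x : F x -> quad_ext (adjoins_field F t r) s x.
  move=> Fx; apply: quad_ext_base; first exact: subfield_subring.
  exact: adjoins_base.
have [||k1 [c _ vc]] := isotropic_division dM _ nrho _ dv av iso.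
- by move=> i; apply: inM.
- move=> i lt; apply: quad_ext_base.
    by have [_ ? _ _ _] := adjoins_division_algebra ioC iu Ht dA.
  by apply: (adjoins_algebra_base ioC iu dA Ht); apply: Av.
(* [v 0] is a scalar [c] and lies in [D], so [c] is in [F]. Since [c^2 = - a0 * rho_0], the vector
   [(c, a0)] is a zero over [F]. *)
have lt0 : (0 < k)%N by rewrite /k k1.
have Fc : F c by apply: (span_monomials_scalar sF); rewrite -vc; apply: Dv.
have cc : c ^+ 2 = - (a0 * rho`_0).
  apply: (fmorph_inj io); have := dv 0%N lt0.
  by rewrite vc -rmorphM -expr2 => ->; rewrite (nth_map 0).
exists (fun i => if i == 0%N then c else if i == 1%N then a0 else 0); split.
- move=> i; case: ifP => // _; case: ifP => _; last exact: subring0.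
  exact: (Frho 0%N).
- by exists 1%N; [rewrite /= k1|exact: (nrho 0%N)].
- by rewrite form_value_cons /form_value k1 big_ord_recl big_ord0 /= cc; ring.
Qed.

End Universal.
End CliffordSystems.

(** * Steps of the tower *)

Section Enumerable.
Variable K : fieldType.
Implicit Types F : K -> Prop.

Definition enumerable F := exists e : nat -> K, forall x, F x -> exists n, e n = x.

Lemma enumerable_countType (C : countType) (f : C -> K) F :
  (forall x, F x -> exists c, f c = x) -> enumerable F.
Proof.
move=> H; exists (fun n => if unpickle n is Some c then f c else 0) => x /H[c <-].
by exists (pickle c); rewrite pickleK.
Qed.

Lemma enumerable_mono F F' : (forall x, F x -> F' x) -> enumerable F' -> enumerable F.
Proof. by move=> FF [e He]; exists e => x /FF/He. Qed.

Lemma poly_in_enum F e p : (forall x, F x -> exists n, e n = x) -> poly_in F p ->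
  exists s : seq nat, p = Poly [seq e n | n <- s].
Proof.
move=> He Fp; have /choice[g Hg] : forall i, exists n, e n = p`_i by move=> i; apply: He.
exists [seq g i | i <- iota 0 (size p)]; rewrite -map_comp.
rewrite (eq_map (g := nth 0 p)) => [|i /=]; last exact: Hg.
by rewrite map_nth_iota0 // take_size polyseqK.
Qed.

Lemma enumerable_adjoin F t : subfield F -> enumerable F -> enumerable (adjoin_field F t).
Proof.
move=> sF [e He].
apply: (@enumerable_countType (seq nat * seq nat)%type
  (fun s => (Poly [seq e n | n <- s.1]).[t] / (Poly [seq e n | n <- s.2]).[t])).
move=> x /adjoin_fieldP[p [b [Fp Fb _ ->]]].
have [s ->] := poly_in_enum He Fp; have [s' ->] := poly_in_enum He Fb.
by exists (s, s').
Qed.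

Lemma enumerable_adjoins F t m : subfield F -> enumerable F -> enumerable (adjoins_field F t m).
Proof.
by move=> sF eF; elim: m => //= m IH; apply: enumerable_adjoin => //; apply: adjoins_subfield.
Qed.

Lemma enumerable_quad_ext F s : enumerable F -> enumerable (quad_ext F s).
Proof.
move=> [e He]; apply: (@enumerable_countType (nat * nat)%type (fun n => e n.1 + e n.2 * s)).
by move=> _ [y [z [/He[m <-] /He[n <-] ->]]]; exists (m, n).
Qed.

Lemma eq_adjoins_field F t t' m : (forall i, (i < m)%N -> t i = t' i) ->
  adjoins_field F t m = adjoins_field F t' m.
Proof.
elim: m => //= m IH E; rewrite E // IH // => i lt; apply: E; exact: ltnW.
Qed.

Lemma ex_independent_transcendentals F m :
  (forall F', subfield F' -> enumerable F' -> exists t, transcendental F' t) ->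
  subfield F -> enumerable F -> exists t, independent_transcendentals F t m.
Proof.
move=> ext sF eF; elim: m => [|m [t Ht]]; first by exists (fun=> 0).
have [x Hx] := ext _ (adjoins_subfield t m sF) (enumerable_adjoins t m sF eF).
exists (fun i => if i == m then x else t i) => k; rewrite ltnS => km.
have E : adjoins_field F (fun i => if i == m then x else t i) k = adjoins_field F t k.
  by apply: eq_adjoins_field => i lt; rewrite ltn_eqF // (leq_trans lt).
rewrite E; move: km; rewrite leq_eqVlt => /orP[/eqP->|lt]; first by rewrite eqxx.
by rewrite ltn_eqF //; apply: Ht.
Qed.

Lemma transcendental_neq0 F t : subfield F -> transcendental F t -> t != 0.
Proof.
move=> sF Ht; apply/eqP => t0.
have := Ht 'X (poly_inX (subfield_subring sF)); rewrite hornerX => /(_ t0)/eqP.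
by rewrite polyX_eq0.
Qed.

Hypothesis two : 2%:R != 0 :> K.

(** Isotropy is read as isotropy after adjoining a square root of the constant [1 = 1 + 0 * t^2],
    which brings [sqrt_isotropic_specialize] to bear. *)
Lemma isotropic_adjoin F t psi : subfield F -> transcendental F t -> coefs_in F psi ->
  isotropic (adjoin_field F t) psi -> isotropic F psi.
Proof.
move=> sF Ht Fpsi [x [Fx [i lt nx] E]]; have rF := subfield_subring sF.
apply: (@sqrt_isotropic_sqr _ two F psi 1) => //; first exact: subring1.
  exact: oner_neq0.
have -> : 1 ^+ 2 = 1 + 0 * 0 ^+ 2 :> K by rewrite mul0r addr0 expr1n.
apply: (@sqrt_isotropic_specialize _ F psi t) => //; try exact: subring0.
  exact: subring1.
exists x, (fun=> 0); split.
- move=> k; split=> //; apply: subring0; exact/subfield_subring/adjoin_subfield.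
- by exists i => //; rewrite nx.
- by rewrite E /form_value big1 ?mulr0 ?addr0 // => k _; rewrite expr0n mulr0.
- by rewrite /polar_value big1 // => k _; rewrite mulr0.
Qed.

(** Take a zero with polynomial coordinates, not all divisible by [X]. Modulo [X], the coordinates
    belonging to [rho] form a zero of [rho], so they are divisible by [X]; then [X] divides the
    square of the first coordinate as well, a contradiction. *)
Lemma generic_value_not_represented F t rho : subfield F -> transcendental F t ->
  coefs_in F rho -> ~ isotropic F rho ->
  ~ isotropic (adjoin_field F t) (- t :: rho).
Proof.
move=> sF Ht Frho nrho [x [Fx [i lt nx] E]].
have rF := subfield_subring sF; have pF := poly_in_subring rF.
set n := size rho in lt *.
have [|c [Fc nc] Hc] := @common_denominator K K idfun (fun _ _ => mulrC _ _) F F t sF rF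
    (fun _ h => h) 'I_n.+1 (fun k => x k).
  by move=> k; apply: Fx.
have /choice[p Hp] : forall k : 'I_n.+1, exists p, poly_in F p /\ c.[t] * x k = p.[t].
  by move=> k; have [p ? ?] := Hc k; exists p.
have Fp k : poly_in F (p k) by case: (Hp k).
have F0 := subring0 rF.
have [|k [q [Hq Fq [j nj]]]] := poly_in_primitive sF F0 Fp.
  exists (Ordinal lt); apply: contraNneq nx => p0.
  by have [_] := Hp (Ordinal lt); rewrite p0 horner0 => /eqP; rewrite mulf_eq0 (negbTE nc).
pose S (h : 'I_n.+1 -> {poly K}) := \sum_(l < n) (rho`_l)%:P * h (lift ord0 l) ^+ 2.
have FS h : (forall l, poly_in F (h l)) -> poly_in F (S h).
  move=> Fh; apply: (subring_sum pF) => l _; apply: (subringM pF); first exact: poly_inC.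
  exact: (subringX pF).
have Ep : S p - 'X * p ord0 ^+ 2 = 0.
  apply: Ht.
    apply: (subringB pF); first exact: FS.
    by apply: (subringM pF); [exact: poly_inX|exact: (subringX pF)].
  rewrite hornerD hornerN hornerM hornerX horner_exp -(Hp ord0).2.
  have -> : (S p).[t] = c.[t] ^+ 2 * form_value rho (fun l => x l.+1).
    rewrite horner_sum mulr_sumr; apply: eq_bigr => l _.
    by rewrite hornerM hornerC horner_exp -(Hp (lift ord0 l)).2 /=; ring.
  by rewrite -[RHS](mulr0 (c.[t] ^+ 2)) -E form_value_cons /=; ring.
have Eq : S q = 'X * q ord0 ^+ 2.
  apply/eqP; rewrite -subr_eq0; apply/eqP.
  have : ('X - 0%:P) ^+ (k + k) * (S q - 'X * q ord0 ^+ 2) = 0.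
    rewrite -[RHS]Ep mulrBr /S mulr_sumr; congr (_ - _); last by rewrite Hq exprD; ring.
    by apply: eq_bigr => l _; rewrite Hq exprD; ring.
  by move/eqP; rewrite mulf_eq0 expf_eq0 polyXsubC_eq0 andbF => /eqP.
have q0 (l : 'I_n) : (q (lift ord0 l)).[0] = 0.
  apply/eqP/negP => /negP nl; apply: nrho.
  exists (fun m => if insub m is Some l' then (q (lift ord0 (l' : 'I_n))).[0] else 0); split.
  - by move=> m; case: insubP => // l' _ _; apply: poly_in_horner.
  - by exists l => //; rewrite valK.
  - transitivity (S q).[0]; last by rewrite Eq hornerM hornerX mul0r.
    by rewrite horner_sum; apply: eq_bigr => l' _; rewrite valK hornerM hornerC horner_exp.
have /choice[g Hg] : forall l : 'I_n, exists g, q (lift ord0 l) = 'X * g.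
  move=> l; have [g _ Eg] := poly_in_factor sF (Fq _) F0 (q0 l).
  by exists g; rewrite Eg subr0.
have E2 : q ord0 ^+ 2 = 'X * \sum_(l < n) (rho`_l)%:P * g l ^+ 2.
  apply: (@mulfI _ ('X : {poly K})); rewrite ?polyX_eq0 // -Eq /S mulr_sumr mulr_sumr.
  by apply: eq_bigr => l _; rewrite Hg; ring.
have q00 : (q ord0).[0] = 0.
  have := congr1 (fun P => P.[0]) E2; rewrite horner_exp hornerM hornerX mul0r => /eqP.
  by rewrite sqrf_eq0 => /eqP.
by case: (unliftP ord0 j) nj => [l ->|->]; rewrite ?q0 ?q00 eqxx.
Qed.

End Enumerable.

Lemma division_algebra_span (K : fieldType) (R : nzRingType) (io : {rmorphism K -> R})
    (T : finType) (b : T -> R) (F : K -> Prop) (B : R -> Prop) :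
  division_algebra io b F B -> (forall i, B (b i)) ->
  division_algebra io b F (span io F b).
Proof.
move=> dA Bb; suff -> : span io F b = B by [].
have [sF sB FB Bs _] := dA.
apply/funext => x; apply/propext; split=> [[c Fc ->]|]; last exact: Bs.
by apply: (subring_sum sB) => i _; apply: (subringM sB) => //; apply: FB.
Qed.

Section Stages.
Variables (K : fieldType) (R : nzRingType) (io : {rmorphism K -> R}).
Hypothesis ioC : forall a x, io a * x = x * io a.
Hypothesis two : 2%:R != 0 :> K.
Hypothesis sqrtK : forall a : K, exists s, s * s = a.
Hypothesis trK : forall F : K -> Prop, subfield F -> enumerable F ->
  exists t, transcendental F t.
Variables (u : nat -> R) (d : nat -> K) (r : nat).
Hypotheses (au : anticommuting u r)
           (du : forall i, (i < r)%N -> u i * u i = io (d i))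
           (iu : independent io (@monomials R u r))
           (nd : forall i, (i < r)%N -> d i != 0) (odd_r : odd r).

Definition clifford_span F := span io F (@monomials R u r).

(** The form [q], with coefficients arranged so that [clifford_squares] with leading coefficient 1
    gives back the squares [d i] of the generators of [D]. *)
Definition clifford_form := 1 :: mkseq (fun i => - d i) r.

(* [F] is the field being built and [M] plays the role of [F(q)]: forms over [F]
   that are anisotropic over [M] have to stay anisotropic for ever, those that
   are isotropic over [M] will be made isotropic. Countability of [M] provides
   transcendental elements. *)
Definition stage (F M : K -> Prop) :=
  [/\ subfield F /\ subfield M, forall a, F a -> M a, enumerable M, forall i, F (d i) &
      division_algebra io (@monomials R u r) F (clifford_span F) /\
      isotropic M clifford_form].

(** [M'] may fail to contain [M], since [stage_refresh] starts again from [F]. What is transmitted,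
    in contrapositive form, is anisotropy over [M] of forms over [F]. *)
Definition stage_le (F M F' M' : K -> Prop) :=
  (forall a, F a -> F' a) /\
  forall psi, coefs_in F psi -> isotropic M' psi -> isotropic M psi.

Lemma stage_le_trans F M F1 M1 F2 M2 :
  stage_le F M F1 M1 -> stage_le F1 M1 F2 M2 -> stage_le F M F2 M2.
Proof.
move=> [FF MM] [FF1 MM1]; split=> [a /FF/FF1 //|psi Fpsi /MM1 H].
by apply: MM => //; apply: H => i; apply: FF.
Qed.

Lemma form_value_clifford x :
  form_value clifford_form x = x 0%N ^+ 2 - \sum_(i < r) d i * x i.+1 ^+ 2.
Proof.
rewrite form_value_cons mul1r /form_value size_mkseq -sumrN; congr (_ + _).
by apply: eq_bigr => i _; rewrite nth_mkseq // mulNr.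
Qed.

Lemma monomials_in_span F i : subfield F -> (i < r)%N -> clifford_span F (u i).
Proof. by move=> sF lt; rewrite -(monomial_gen u lt); apply: span_monomial. Qed.

Lemma stage_refresh F M : stage F M -> exists t s,
  [/\ independent_transcendentals F t r, s * s = \sum_(i < r) d i * t i ^+ 2,
      stage F (quad_ext (adjoins_field F t r) s)
    & stage_le F M F (quad_ext (adjoins_field F t r) s)].
Proof.
move=> [[sF sM] FM eM Fd [dD iso]].
have [t Ht] := ex_independent_transcendentals r trK sM eM.
have [s ss] := sqrtK (\sum_(i < r) d i * t i ^+ 2).
have HtF := independent_transcendentals_mono FM Ht.
have sFt := adjoins_subfield t r sF.
have sM1 : subfield (quad_ext (adjoins_field F t r) s).
  by apply: quad_ext_subfield => //; rewrite ss; apply: adjoins_form.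
have base x : adjoins_field F t r x -> quad_ext (adjoins_field F t r) s x.
  by apply: quad_ext_base; apply: subfield_subring.
have r0 : (0 < r)%N by case: (r) odd_r.
exists t, s; split=> //.
- split=> //.
  + by move=> a Fa; apply: base; apply: adjoins_base.
  + by apply/enumerable_quad_ext/enumerable_adjoins => //; apply: enumerable_mono eM.
  split=> //; exists (fun i => if i is k.+1 then (if (k < r)%N then t k else 0) else s); split.
  + case=> [|k]; first by apply: quad_ext_gen; apply: subfield_subring.
    case: ifP => kr; first by apply: base; apply: adjoins_gen.
    exact: subring0 (subfield_subring sM1).
  + exists 1%N; first by rewrite /= size_mkseq.
    by rewrite r0; apply: (transcendental_neq0 sF); apply: (HtF 0%N).
  + rewrite form_value_clifford expr2 ss; apply/eqP; rewrite subr_eq0; apply/eqP.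
    by apply: eq_bigr => i _; rewrite ltn_ord.
- split=> // psi Fpsi /(isotropic_mono (F' := quad_ext (adjoins_field M t r) s)) H.
  have rM := subfield_subring sM.
  have [|||x [Mx nx]] := @isotropic_leading _ two M 1 (mkseq (fun i => - d i) r)
    sM _ (oner_neq0 _) _ _ iso.
  + exact: subring1.
  + move=> i; have [lt|ge] := ltnP i r; last by rewrite nth_default ?size_mkseq //; apply: subring0.
    by rewrite nth_mkseq //; apply: (subringN rM); apply: FM.
  + by move=> i; rewrite size_mkseq => lt; rewrite nth_mkseq // oppr_eq0 nd.
  rewrite form_value_clifford => /eqP; rewrite subr_eq0 => /eqP Ex.
  apply: (function_field_anisotropic two sM Ht (d := d) (e := fun i => x i.+1)
    (c := x 0%N) _ _ _ _ _ _ ss) => //.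
  + by move=> i; apply: FM.
  + by move=> i; apply: FM.
  + by apply: H => a; apply: quad_ext_mono => y; apply: adjoins_mono.
Qed.

Lemma stage_generic F M t : stage F M -> transcendental M t ->
  stage (adjoin_field F t) (adjoin_field M t) /\
  stage_le F M (adjoin_field F t) (adjoin_field M t).
Proof.
move=> [[sF sM] FM eM Fd [dD iso]] Ht.
have HtF := transcendental_mono FM Ht.
split; last first.
  split=> [a|psi Fpsi]; first exact: adjoin_field_base.
  by apply: isotropic_adjoin => // i; apply: FM.
split.
- by split; apply: adjoin_subfield.
- by move=> a; apply: adjoin_mono.
- exact: enumerable_adjoin.
- by move=> i; apply: adjoin_field_base.
split; last by apply: isotropic_mono iso => a; apply: adjoin_field_base.
apply: (division_algebra_span (adjoin_division_algebra ioC iu HtF dD)) => f.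
have [_ sD _ _ _] := dD.
by apply: adjoin_base => //; apply: span_base.
Qed.

(* After replacing [M] by a generic [F(q)], either [rho] is anisotropic over [M]
   and a new transcendental is a value that will never be represented, or the
   function field of [rho] keeps the Clifford algebra of [q] division. *)
Lemma stage_step F M rho : stage F M -> coefs_in F rho -> nonzero_coefs rho ->
  size rho != r.+1 -> exists F' M', [/\ stage F' M', stage_le F M F' M' &
    isotropic F' rho \/ exists w, [/\ F' w, w != 0 & ~ isotropic M' (- w :: rho)]].
Proof.
move=> stFM Frho nrho srho.
have [t0 [s0 [Ht0 ss0]]] := stage_refresh stFM.
set M1 := quad_ext _ _ => stM1 leM1.
have [[sF sM1] FM1 eM1 Fd [dD isoq]] := stM1.
have [iso|naniso] := pselect (isotropic M1 rho); last first.
  have [t Ht] := trK sM1 eM1.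
  have [st le] := stage_generic stM1 Ht.
  exists (adjoin_field F t), (adjoin_field M1 t); split=> //.
    exact: stage_le_trans leM1 le.
  right; exists t; split; [exact: adjoin_field_gen|exact: transcendental_neq0 sM1 Ht|].
  by apply: generic_value_not_represented => // i; apply: FM1.
have [isoF|nisoF] := pselect (isotropic F rho); first by exists F, M1; split=> //; left.
case: rho => [|a0 rho] in Frho nrho srho iso nisoF *; first by case: iso => x [_ []].
have na0 : a0 != 0 by apply: (nrho 0%N).
have Fa0 : F a0 by apply: (Frho 0%N).
have rF := subfield_subring sF.
pose m := size rho; pose d' i := - (a0 * rho`_i).
have sqE : clifford_squares a0 rho = mkseq d' m.
  apply: (eq_from_nth (x0 := 0)); rewrite ?size_map ?size_iota // => i lt.
  by rewrite (nth_map 0) // nth_mkseq.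
have Fd' i : F (d' i).
  by apply: (subringN rF); apply: (subringM rF) => //; apply: (Frho i.+1).
have m0 : (0 < m)%N.
  rewrite lt0n; apply/eqP => m0; case: iso => x [_ [i +]]; rewrite /= -/m m0 ltnS leqn0 => /eqP->.
  rewrite form_value_cons /form_value -/m m0 big_ord0 addr0 => nx /eqP.
  by rewrite mulf_eq0 (negbTE na0) sqrf_eq0 (negbTE nx).
have [t Ht] := ex_independent_transcendentals m trK sM1 eM1.
have [s ss] := sqrtK (\sum_(i < m) d' i * t i ^+ 2).
have HtF := independent_transcendentals_mono FM1 Ht.
pose F' := quad_ext (adjoins_field F t m) s; pose M' := quad_ext (adjoins_field M1 t m) s.
have sFt := adjoins_subfield t m sF; have sMt := adjoins_subfield t m sM1.
have sF' : subfield F' by apply: quad_ext_subfield => //; rewrite ss; apply: adjoins_form.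
have sM' : subfield M'.
  by apply: quad_ext_subfield => //; rewrite ss; apply: adjoins_form => // i; apply: FM1.
have baseF x : adjoins_field F t m x -> F' x.
  by apply: quad_ext_base; apply: subfield_subring.
have FF' x : F x -> F' x by move=> Fx; apply/baseF/adjoins_base.
have MM' x : M1 x -> M' x.
  move=> Mx; apply: quad_ext_base; first exact: subfield_subring.
  exact: adjoins_base.
have dF' : division_algebra io (@monomials R u r) F' (clifford_span F').
  have [sys|dF'] := function_field_division ioC iu dD HtF Fd' ss; last first.
    apply: (division_algebra_span dF') => f; have [_ sD _ _ _] := dD.
    apply: quad_ext_base; first by have [] := adjoins_division_algebra ioC iu HtF dD.
    by apply: (adjoins_algebra_base ioC iu dD HtF); apply: span_base.
  (* With fewer than [r] generators, descent makes the form isotropic over [F]. With more, the first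
     [r + 1], an even number, are too many for dimension [2 ^ r]. *)
  exfalso; have [lt|gt|E] := ltngtP m r; last by move: srho; rewrite /= -/m E eqxx.
    apply: nisoF.
    apply: (function_field_isotropic_descent ioC two au du iu Fd dD Frho nrho lt _ Ht0 ss0 iso).
    by rewrite sqE.
  have [_ sD _ Ds _] := dD.
  have sz : size (take r.+1 (mkseq d' m)) = r.+1.
    by rewrite size_take_min size_mkseq; apply/minn_idPl.
  have := clifford_system_card ioC two sF sD Ds (clifford_system_take r.+1 sys).
  rewrite sz card_monomials /= negbK => /(_ odd_r); rewrite leq_exp2l // ltnn.
  suff H : nonzero_coefs (take r.+1 (mkseq d' m)) by move/(_ H).
  move=> i; rewrite sz => lt; rewrite nth_take // nth_mkseq ?(leq_trans lt) //.
  by rewrite oppr_eq0 mulf_neq0 //; apply: (nrho i.+1); rewrite /= ltnS; apply: leq_trans lt gt.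
exists F', M'; split.
- split=> //.
  + by move=> a; apply: quad_ext_mono => y; apply: adjoins_mono.
  + by apply/enumerable_quad_ext/enumerable_adjoins.
  + by move=> i; apply: FF'.
  + by split=> //; apply: isotropic_mono isoq.
- apply: (stage_le_trans leM1); split=> // psi Fpsi.
  (* The form has a zero over [M1], at which its generic point is specialised. The constant
     [a0 * x 0] below has square [\sum_i d' i * x_(i+1)^2]. *)
  have [|||x [Mx nx]] := @isotropic_leading _ two M1 a0 rho sM1 _ na0 _ _ iso.
  + exact: FM1.
  + by move=> i; apply: FM1; apply: (Frho i.+1).
  + by move=> i lt; apply: (nrho i.+1).
  rewrite form_value_cons addrC => /eqP; rewrite addr_eq0 => /eqP Ex.
  apply: (function_field_anisotropic two sM1 Ht (d := d') (e := fun i => x i.+1)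
    (c := a0 * x 0%N)) => //.
  + by move=> i; apply: FM1.
  + by move=> i; apply: FM1.
  + by apply: (subringM (subfield_subring sM1)) => //; apply: FM1.
  + exact: mulf_neq0.
  + transitivity (- a0 * form_value rho (fun i => x i.+1)); last by rewrite Ex; ring.
    by rewrite /form_value mulr_sumr; apply: eq_bigr => i _; rewrite /d'; ring.
(* The generic zero; the factor [a0] compensates for the one in [d' i = - (a0 * rho_i)]. *)
- left; exists (fun i => if i is k.+1 then (if (k < m)%N then a0 * t k else 0) else s); split.
  + have rF' := subfield_subring sF'.
    case=> [|k]; first by apply: quad_ext_gen; apply: subfield_subring.
    case: ifP => km; last exact: subring0.
    by apply: (subringM rF'); [exact: FF'|apply: baseF; apply: adjoins_gen].
  + exists 1%N => //; rewrite m0 mulf_neq0 //.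
    by apply: (transcendental_neq0 sF); apply: (HtF 0%N).
  + rewrite form_value_cons expr2 ss mulr_sumr /form_value -big_split /= big1 // => i _.
    by rewrite ltn_ord /d'; ring.
Qed.

End Stages.

(** * The limit of the tower *)

Section Union.
Variables (K : fieldType) (F : nat -> K -> Prop).
Hypotheses (sF : forall n, subfield (F n))
           (mF : forall m n x, (m <= n)%N -> F m x -> F n x).

Definition union_field x := exists n, F n x.

Lemma union_field2 x y : union_field x -> union_field y -> exists n, F n x /\ F n y.
Proof.
move=> [m Fx] [n Fy]; exists (maxn m n).
by split; [apply: mF Fx; apply: leq_maxl|apply: mF Fy; apply: leq_maxr].
Qed.

Lemma union_subfield : subfield union_field.
Proof.
split=> [|x y Ux Uy|x y Ux Uy|x [n Fx]].
- by exists 0%N; apply: subring1; apply: subfield_subring.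
- have [n [Fx Fy]] := union_field2 Ux Uy.
  by exists n; apply: subringB => //; apply: subfield_subring.
- have [n [Fx Fy]] := union_field2 Ux Uy.
  by exists n; apply: subringM => //; apply: subfield_subring.
- by exists n; apply: subfieldV.
Qed.

Lemma union_field_seq (x : nat -> K) m : (forall i, (i < m)%N -> union_field (x i)) ->
  exists n, forall i, (i < m)%N -> F n (x i).
Proof.
elim: m => [|m IH] H; first by exists 0%N.
have [|n Hn] := IH; first by move=> i lt; apply: H; apply: ltnW.
have [k Hk] := H m (ltnSn m); exists (maxn n k) => i; rewrite ltnS leq_eqVlt.
case/orP=> [/eqP->|lt]; first by apply: mF Hk; apply: leq_maxr.
by apply: mF (Hn _ lt); apply: leq_maxl.
Qed.

Lemma union_isotropic rho : isotropic union_field rho -> exists n, isotropic (F n) rho.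
Proof.
move=> [x [Ux [i lt nx] E]].
have [n Hn] := union_field_seq (m := size rho) (fun i _ => Ux i).
exists n, (fun k => if (k < size rho)%N then x k else 0); split.
- move=> k; case: ifP => lk; first exact: Hn.
  by apply: subring0; apply: subfield_subring.
- by exists i; rewrite ?lt.
- by rewrite -[RHS]E; apply: eq_bigr => k _; rewrite ltn_ord.
Qed.

End Union.

(** Used to find, among the infinitely many codes of a task, one that comes after a given stage. *)
Lemma injective_unbounded (f : nat -> nat) n : injective f -> exists k, (n <= f k)%N.
Proof.
move=> If; apply: contrapT => H.
have lt k : (f k < n)%N by rewrite ltnNge; apply/negP => le; apply: H; exists k.
have : injective (fun k : 'I_n.+1 => Ordinal (lt k)).
  by move=> k l /(congr1 val) /= /If; apply: val_inj.
by move/leq_card; rewrite !card_ord ltnn.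
Qed.

Section Tower.
Variables (K : fieldType) (R : nzRingType) (io : {rmorphism K -> R}).
Hypothesis ioC : forall a x, io a * x = x * io a.
Hypothesis two : 2%:R != 0 :> K.
Hypothesis sqrtK : forall a : K, exists s, s * s = a.
Hypothesis trK : forall F : K -> Prop, subfield F -> enumerable F ->
  exists t, transcendental F t.
Variables (u : nat -> R) (d : nat -> K) (r : nat).
Hypotheses (au : anticommuting u r)
           (du : forall i, (i < r)%N -> u i * u i = io (d i))
           (iu : independent io (@monomials R u r))
           (nd : forall i, (i < r)%N -> d i != 0) (odd_r : odd r).

Lemma gen_not_scalar k a : (k < r)%N -> u k <> io a.
Proof.
move=> kr E; pose o : {ffun 'I_r -> bool} := [ffun=> false].
pose g : {ffun 'I_r -> bool} := [ffun i : 'I_r => (i == k :> nat)].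
have go : (g == o) = false.
  by apply/eqP => /ffunP/(_ (Ordinal kr)); rewrite !ffunE /= eqxx.
have Eg : monomials u g = u k.
  rewrite -(monomial_gen u kr); apply: eq_monomial => i lt.
  by rewrite (bitsE g (Ordinal lt)) ffunE.
have Eo : monomials u o = 1.
  rewrite -(monomial1 u r); apply: eq_monomial => i lt.
  by rewrite (bitsE o (Ordinal lt)) ffunE.
suff /(_ g)/eqP : forall h, (h == g)%:R - a * (h == o)%:R = 0 :> K.
  by rewrite eqxx go mulr0 subr0 oner_eq0.
have og : (o == g) = false by rewrite eq_sym.
apply: iu; rewrite (bigD1 g) //= (bigD1 o) ?og //= !eqxx go.
rewrite mulr0 subr0 rmorph1 Eg Eo mul1r !mulr1 sub0r rmorphN E addrA subrr add0r.
rewrite big1 // => h /andP[/negbTE-> /negbTE->].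
by rewrite mulr0 subrr rmorph0 mul0r.
Qed.

Lemma clifford_form_anisotropic F : subfield F -> (forall i, F (d i)) ->
  division_algebra io (@monomials R u r) F (clifford_span io u r F) ->
  ~ isotropic F (clifford_form d r).
Proof.
move=> sF Fd dD iso; have rF := subfield_subring sF.
have sz : size (mkseq (fun i => - d i) r) = r by rewrite size_mkseq.
have sq i : (i < r)%N -> (clifford_squares 1 (mkseq (fun i => - d i) r))`_i = d i.
  by move=> lt; rewrite (nth_map 0) ?sz // nth_mkseq // mul1r opprK.
have [|||||r1 [c _]] := @isotropic_division _ _ _ ioC two _ _ _ _ _ _ u dD _ _ _ _ _ iso.
- case=> [|i] /=; first exact: subring1.
  have [lt|ge] := ltnP i r; last by rewrite nth_default ?sz //; apply: subring0.
  by rewrite nth_mkseq //; apply: subringN.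
- case=> [|i] /=; first by rewrite oner_neq0.
  by rewrite ltnS sz => lt; rewrite nth_mkseq // oppr_eq0 nd.
- by rewrite sz => i; apply: monomials_in_span.
- by rewrite sz => i lt; rewrite sq // du.
- by rewrite sz.
- by apply: gen_not_scalar; rewrite -sz r1.
Qed.

Let stage := stage io u d r.
Let solves (F M : K -> Prop) rho :=
  isotropic F rho \/ exists w, [/\ F w, w != 0 & ~ isotropic M (- w :: rho)].

(** The last clause is what makes [q] universal: a form [a :: q] is isotropic over every [M] because
    [q] is, so only the first alternative remains for it. *)
Lemma stage_limit F0 M0 : stage F0 M0 -> exists F : K -> Prop,
  [/\ subfield F, forall i, F (d i), ~ isotropic F (clifford_form d r) &
   forall rho, coefs_in F rho -> nonzero_coefs rho -> size rho != r.+1 ->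
     isotropic F rho \/ exists w, [/\ F w, w != 0, ~ isotropic F (- w :: rho) &
       forall a, rho <> a :: clifford_form d r]].
Proof.
move=> st0; pose state := {p : (K -> Prop) * (K -> Prop) | stage p.1 p.2}.
pose Fs (S : state) := (sval S).1; pose Ms (S : state) := (sval S).2.
have stS (S : state) : stage (Fs S) (Ms S) := svalP S.
have /choice[e He] : forall S : state, exists e : nat -> K, forall x, Ms S x -> exists n, e n = x.
  by move=> S; have [_ _ ? _ _] := stS S.
have /choice[next Hnext] : forall p : state * seq K, exists S' : state,
    stage_le (Fs p.1) (Ms p.1) (Fs S') (Ms S') /\
    (coefs_in (Fs p.1) p.2 -> nonzero_coefs p.2 -> size p.2 != r.+1 ->
       solves (Fs S') (Ms S') p.2).
  move=> [S rho] /=.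
  have [[Frho nrho srho]|H] := pselect
      [/\ coefs_in (Fs S) rho, nonzero_coefs rho & size rho != r.+1].
    have [F' [M' [st le sol]]] :=
      stage_step ioC two sqrtK trK au du iu nd odd_r (stS S) Frho nrho srho.
    by exists (exist _ (F', M') st).
  by exists S; split=> [|Frho nrho srho]; [split|case: H].
(* A code [(i, s, k)] stands for the form whose coefficients have the indices [s] in the enumeration
   of stage [i]. The dummy [k] gives each form a code [n] with [i <= n], when stage [i] is already
   built. *)
pose task n (L : seq state) (S0 : state) : seq K :=
  if (unpickle n : option (nat * seq nat * nat)) is Some (i, s, _)
  then [seq e (nth S0 L i) k | k <- s] else [::].
have [S0 _] : exists S0 : state, True by exists (exist _ (F0, M0) st0).
(* The whole history is kept, since tasks refer to enumerations of earlier stages. *)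
pose hist := fix hist n := if n is k.+1 then
  rcons (hist k) (next (last S0 (hist k), task k (hist k) S0)) else [:: S0].
pose st n := last S0 (hist n).
have sh n : size (hist n) = n.+1 by elim: n => //= n IH; rewrite size_rcons IH.
have nh n i : (i <= n)%N -> nth S0 (hist n) i = st i.
  elim: n => [|n IH]; first by rewrite leqn0 => /eqP->.
  rewrite leq_eqVlt => /orP[/eqP->|lt].
    by rewrite /st -nth_last sh.
  by rewrite /= nth_rcons sh lt IH.
have stn n : st n.+1 = next (st n, task n (hist n) S0) by rewrite /st /= last_rcons.
have le1 n : stage_le (Fs (st n)) (Ms (st n)) (Fs (st n.+1)) (Ms (st n.+1)).
  by rewrite stn; case: (Hnext (st n, task n (hist n) S0)).
have le m n : (m <= n)%N -> stage_le (Fs (st m)) (Ms (st m)) (Fs (st n)) (Ms (st n)).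
  elim: n => [|n IH]; first by rewrite leqn0 => /eqP->; split.
  rewrite leq_eqVlt => /orP[/eqP->|lt]; first by split.
  exact: stage_le_trans (IH lt) (le1 n).
pose F n := Fs (st n).
have sF n : subfield (F n) by have [[]] := stS (st n).
have mF m n x : (m <= n)%N -> F m x -> F n x by move=> mn; apply: (le m n mn).1.
have FM n x : F n x -> Ms (st n) x by have [_ FM _ _ _] := stS (st n); apply: FM.
exists (union_field F); split.
- exact: union_subfield.
- by move=> i; exists 0%N; have [_ _ _ Fd _] := stS (st 0%N); exact: Fd.
- move=> /(union_isotropic sF mF)[n].
  by apply: clifford_form_anisotropic; have [_ _ _ ? []] := stS (st n).
move=> rho Urho nrho srho.
have [i Hi] := union_field_seq mF (m := size rho) (fun k _ => Urho k).
have Fi k : F i rho`_k.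
  have [lt|ge] := ltnP k (size rho); first exact: Hi.
  by rewrite nth_default //; apply: subring0; apply: subfield_subring.
have /choice[g Hg] : forall k, exists n, e (st i) n = rho`_k.
  by move=> k; apply: He; apply: FM.
pose s := [seq g k | k <- iota 0 (size rho)].
have Es : [seq e (st i) k | k <- s] = rho.
  rewrite -map_comp (eq_map (g := nth 0 rho)) => [|k /=]; last exact: Hg.
  by rewrite map_nth_iota0 // take_size.
have [k ik] : exists k : nat, (i <= pickle (i, s, k))%N.
  by apply: injective_unbounded => k l /(pcan_inj pickleK)[].
set n := pickle _ in ik.
have En : task n (hist n) S0 = rho by rewrite /task pickleK nh.
have := Hnext (st n, task n (hist n) S0); rewrite -stn En => -[_ /= sol].
have {sol} : solves (Fs (st n.+1)) (Ms (st n.+1)) rho.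
  by apply: sol => // l; apply: (mF i).
case=> [iso|[w [Fw nw aniso]]].
  by left; apply: isotropic_mono iso => a Fa; exists n.+1.
right; exists w; split=> // [|iso|a E]; first by exists n.+1.
  have [l {}iso] := union_isotropic sF mF iso; apply: aniso.
  have [_ H] := le n.+1 (maxn n.+1 l) (leq_maxl _ _); apply: H.
    case=> [|k'] /=; first exact: (subringN (subfield_subring (sF n.+1))).
    by apply: (mF i) => //; apply: leqW.
  by apply: isotropic_mono iso => a Fa; apply: FM; apply: mF Fa; apply: leq_maxr.
have [[_ sM] _ _ _ [_ iso]] := stS (st n.+1).
by apply: aniso; rewrite E; do 2![apply: isotropic_cons => //].
Qed.

End Tower.

(** * Generic Clifford algebras *)

Section Pauli.
Variable R : nzRingType.

Definition mx22 (a b c d : R) : 'M[R]_2 :=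
  \matrix_(i, j) if i == 0 then (if j == 0 then a else b) else (if j == 0 then c else d).

Lemma mx22M a b c d a' b' c' d' : mx22 a b c d * mx22 a' b' c' d' =
  mx22 (a * a' + b * c') (a * b' + b * d') (c * a' + d * c') (c * b' + d * d').
Proof.
apply/matrixP => i j; rewrite !mxE !big_ord_recl big_ord0 addr0 !mxE /=.
by case: (i == 0); case: (j == 0).
Qed.

Lemma mx22N a b c d : - mx22 a b c d = mx22 (- a) (- b) (- c) (- d).
Proof. by apply/matrixP => i j; rewrite !mxE; case: (i == 0); case: (j == 0). Qed.

Lemma mx22_scalar a : a%:M = mx22 a 0 0 a.
Proof.
apply/matrixP => i j; rewrite !mxE.
by case: (unliftP 0 i) => [i' ->|->]; case: (unliftP 0 j) => [j' ->|->]; rewrite ?ord1 // ?mulr1n.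
Qed.

Lemma mx22_eta (A : 'M[R]_2) : A = mx22 (A 0 0) (A 0 1) (A 1 0) (A 1 1).
Proof.
apply/matrixP => i j; rewrite !mxE.
by case: i => [[|[|i]] //= Hi]; case: j => [[|[|j]] //= Hj]; congr (A _ _); apply/val_inj.
Qed.

End Pauli.

(** Doubling by Pauli matrices: sigma_x and sigma_y over [R], with [io s] as imaginary unit,
    together with sigma_z times each element of the old family. *)
Lemma ex_anticommuting_involutions (K : fieldType) n :
  (exists s : K, s * s = -1) ->
  exists (R : nzRingType) (io : {rmorphism K -> R}) (g : nat -> R),
  [/\ forall a x, io a * x = x * io a, anticommuting g n.*2 &
      forall i, (i < n.*2)%N -> g i * g i = 1].
Proof.
move=> [s ss]; elim: n => [|n [R [io [g [ioC ag gg]]]]].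
  by exists K, idfun, (fun=> 1); split=> // a x; rewrite mulrC.
exists 'M[R]_2, (scalar_mx \o io).
exists (fun i => if i == n.*2 then mx22 0 1 1 0
  else if i == n.*2.+1 then mx22 0 (- io s) (io s) 0 else mx22 (g i) 0 0 (- g i)).
have ltE i : (i < n.+1.*2)%N -> i != n.*2 -> i != n.*2.+1 -> (i < n.*2)%N by lia.
have simp := (@mul0r R, @mulr0 R, @mul1r R, @mulr1 R, @addr0 R, @add0r R,
  @opprK R, @oppr0 R, @mulrN R, @mulNr R).
split.
- move=> a x; rewrite /= mx22_scalar (mx22_eta x) !mx22M.
  by rewrite !mul0r !mulr0 !addr0 !add0r !ioC.
- move=> i j /ltE lti /ltE ltj ij.
  have [Ei|ni] := eqVneq i n.*2.
    have [Ej|nj] := eqVneq j n.*2; first by case/eqP: ij; rewrite Ei Ej.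
    by have [_|_] := eqVneq j n.*2.+1; rewrite !mx22M mx22N !simp.
  have [Ei'|ni'] := eqVneq i n.*2.+1.
    have [_|nj] := eqVneq j n.*2; first by rewrite !mx22M mx22N !simp.
    have [Ej|nj'] := eqVneq j n.*2.+1; first by case/eqP: ij; rewrite Ei' Ej.
    by rewrite !mx22M mx22N !simp ioC.
  have [_|nj] := eqVneq j n.*2; first by rewrite !mx22M mx22N !simp.
  have [_|nj'] := eqVneq j n.*2.+1; first by rewrite !mx22M mx22N !simp ioC.
  by rewrite !mx22M mx22N !simp ag ?lti ?ltj.
- move=> i /ltE lti; rewrite -[RHS]/(1%:M) mx22_scalar.
  have [_|ni] := eqVneq i n.*2; first by rewrite mx22M !simp.
  have [_|ni'] := eqVneq i n.*2.+1.
    by rewrite mx22M !simp -rmorphM ss rmorphN1 opprK.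
  by rewrite mx22M !simp gg ?lti.
Qed.

Section GenericAlgebra.
Variables (K : fieldType) (R : nzRingType) (io : {rmorphism K -> R}).
Hypothesis ioC : forall a x, io a * x = x * io a.
Hypothesis two : 2%:R != 0 :> K.
Hypothesis sqrtK : forall a : K, exists s, s * s = a.
Hypothesis trK : forall F : K -> Prop, subfield F -> enumerable F ->
  exists t, transcendental F t.
Variables (g : nat -> R) (N : nat).
Hypotheses (ag : anticommuting g N) (gg : forall i, (i < N)%N -> g i * g i = 1)
  (eN : ~~ odd N).

(** With [c i] a square root of a transcendental element, these generate a Clifford algebra with
    generic coefficients inside the given ring. *)
Definition scaled (c : nat -> K) i := io (c i) * g i.

Lemma scaled_anticommuting c : anticommuting (scaled c) N.
Proof.
move=> i j lti ltj ij; rewrite /scaled -!mulrA (mulrA (g i)) -ioC -!mulrA ag //.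
by rewrite !mulrN (mulrA (g j)) -(ioC (c i)) !mulrA -!rmorphM mulrC.
Qed.

Lemma scaled_sqr c i : (i < N)%N -> scaled c i * scaled c i = io (c i ^+ 2).
Proof.
by move=> lt; rewrite /scaled -!mulrA (mulrA (g i)) -ioC -!mulrA gg // mulr1 -rmorphM.
Qed.

Lemma scaled_monomial c r m :
  monomial (scaled c) r m = io (\prod_(i < r) if m i then c i else 1) * monomial g r m.
Proof.
elim: r => [|r IH]; rewrite /monomial ?big_ord0 ?rmorph1 ?mulr1 //.
rewrite !big_ord_recr /= -!/(monomial _ _ _) IH rmorphM -!mulrA; congr (_ * _).
rewrite (mulrA (io _)) (ioC _ (monomial g r m)) -!mulrA; congr (_ * _).
by case: (m r); rewrite ?rmorph1 ?mul1r.
Qed.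

Lemma scaled_independent c r : (r <= N)%N -> (forall i, (i < r)%N -> c i != 0) ->
  independent io (@monomials R (scaled c) r).
Proof.
move=> rN nc.
have ig : independent io (@monomials R g r).
  rewrite -(subKn rN); elim: (N - r)%N => [|k IH].
    rewrite subn0; apply: (monomials_independent ioC two eN ag (d := fun=> 1)).
      by move=> i lt; rewrite gg // rmorph1.
    by move=> *; apply: oner_neq0.
  have [kN|Nk] := ltnP k N; last by rewrite (eqnP (leqW Nk)) -(eqnP Nk).
  by apply: monomials_independentS; rewrite -subSn // subSS.
move=> e Ee f; set p := \prod_(i < r) (if bits f i then c i else 1).
have np : p != 0 by apply/prodf_neq0 => i _; case: ifP; rewrite ?nc ?oner_neq0.
apply: (mulIf np); rewrite mul0r.
apply: (ig (fun h => e h * \prod_(i < r) (if bits h i then c i else 1))).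
rewrite -[RHS]Ee; apply: eq_bigr => h _.
by rewrite /monomials scaled_monomial rmorphM mulrA.
Qed.

(** [g k] is its own inverse, and conjugation by it multiplies each monomial by a sign. *)
Lemma conjugation_span F c r k x : subfield F -> (r <= k)%N -> (k < N)%N ->
  span io F (@monomials R (scaled c) r) x ->
  span io F (@monomials R (scaled c) r) (g k * x * g k).
Proof.
move=> sF rk kN [e Fe ->]; rewrite mulr_sumr mulr_suml.
apply: (span_sum sF) => f _; rewrite mulrA -ioC -!mulrA; apply: (spanZ sF) => //.
rewrite /monomials scaled_monomial -(mulrA (io _)) (mulrA (g k) (io _)) -(ioC _ (g k)).
rewrite -(mulrA (io _)) (mulrA (g k) (monomial g r _)).
rewrite (monomial_sign _ ag (leq_trans rk (ltnW kN)) kN) -!mulrA gg // mulr1.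
rewrite -(rmorphN1 io) -rmorphXn (mulrA (io _)) -rmorphM mulrC rmorphM -mulrA -scaled_monomial.
apply: (spanZ sF); last exact: span_monomial.
have rF := subfield_subring sF.
by apply: (subringX rF); apply: (subringN rF); apply: subring1.
Qed.

(* Adjoining [u] with [u^2 = t] transcendental: a relation
   [sigma x * x = t] is impossible since the left side has even degree in [t]. *)
Lemma generic_division_algebra F c k t s : (k < N)%N ->
  (forall i, (i < k)%N -> c i != 0) -> transcendental F t -> s * s = t ->
  division_algebra io (@monomials R (scaled c) k) F (span io F (@monomials R (scaled c) k)) ->
  let c' i := if i == k then s else c i in
  division_algebra io (@monomials R (scaled c') k.+1) (adjoin_field F t)
    (span io (adjoin_field F t) (@monomials R (scaled c') k.+1)).
Proof.
move=> kN nc Ht ss dB c'.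
have ib := scaled_independent (ltnW kN) nc.
have [sF sB FB Bb divB] := dB.
set B := span _ _ _ in dB sB FB Bb divB.
have Em m : monomial (scaled c') k m = monomial (scaled c) k m.
  by apply: eq_bigr => i _; rewrite /scaled /c' ltn_eqF.
have := adjoin_division_algebra ioC ib Ht dB.
set F' := adjoin_field F t; set B' := adjoin io F B t => -[sF' sB' FB' Bb' divB'].
have uu : scaled c' k * scaled c' k = io t by rewrite scaled_sqr // /c' eqxx expr2 ss.
have Bt : B' (io t) by apply: (adjoin_gen io t sF sB).
have conjB x : B x -> B (g k * x * g k) by apply: conjugation_span.
(* [g k] commutes with [io t], so conjugation acts on polynomials coefficientwise. *)
have conjE (P : {poly R}) : (\poly_(i < size P) (g k * P`_i * g k)).[io t] = g k * P.[io t] * g k.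
  rewrite horner_poly horner_coef mulr_sumr mulr_suml; apply: eq_bigr => i _.
  by rewrite -rmorphXn -!ioC (mulrA (g k) (io _)) -(ioC _ (g k)) !mulrA.
have conjP (P : {poly R}) : poly_in B P -> poly_in B (\poly_(i < size P) (g k * P`_i * g k)).
  by move=> BP i; rewrite coef_poly; case: ifP => _; [exact: conjB|exact: (subring0 sB)].
have [|||sQ dQ] := @quad_ext_division R B' (scaled c' k) (fun y => g k * y * g k) sB' divB'.
- by rewrite uu.
- move=> _ [P [b [BP Fb nb ->]]]; split.
    exists (\poly_(i < size P) (g k * P`_i * g k)), b; split=> //; first exact: conjP.
    by rewrite conjE !mulrA -ioC.
  set y := _ * P.[_]; rewrite /scaled (mulrA (g k * y * g k)) -ioC -!mulrA gg //.
  by rewrite mulr1.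
- move=> _ [P [b [BP Fb nb ->]]]; apply/negP => /eqP E.
  have nbb : b.[t] ^+ 2 != 0 by rewrite expf_neq0.
  (* Clearing denominators gives an identity with right side [b^2 X] in [B[X]]. Conjugation
     preserves the degree of [P], so the two sides have degrees of different parity. *)
  have EP : (\poly_(i < size P) (g k * P`_i * g k) * P).[io t] = (map_poly io (b ^+ 2 * 'X)).[io t].
    rewrite central_hornerM // conjE horner_map hornerM hornerX horner_exp rmorphM.
    move: E; set Q := P.[io t] => E; rewrite -uu -E.
    have -> : g k * (io b.[t]^-1 * Q) * g k * (io b.[t]^-1 * Q) =
        io (b.[t]^-1 * b.[t]^-1) * (g k * Q * g k * Q).
      rewrite (mulrA (g k) (io _)) -(ioC _ (g k)) rmorphM -!mulrA; congr (_ * _).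
      by rewrite !mulrA -ioC !mulrA.
    by rewrite [RHS]mulrA -(rmorphM io) -invfM -expr2 mulfV // rmorph1 mul1r.
  have rF := subfield_subring sF; have pF := poly_in_subring rF.
  have {}EP := poly_in_eq ioC ib dB Ht (subringM (poly_in_subring sB) (conjP _ BP) BP)
    (poly_in_map FB (subringM pF (subringX pF 2 Fb) (poly_inX rF))) EP.
  have nP : P != 0.
    apply: contra_eq_neq EP => ->; rewrite mulr0 eq_sym map_poly_eq0 mulf_neq0 ?polyX_eq0 //.
    by rewrite expf_neq0 //; apply: contraNneq nb => ->; rewrite horner0.
  have nb0 : b != 0 by apply: contraNneq nb => ->; rewrite horner0.
  have sz : size (\poly_(i < size P) (g k * P`_i * g k)) = size P.
    apply: size_poly_eq; apply: contraNneq nP => E0.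
    rewrite -lead_coef_eq0 lead_coefE.
    have := congr1 (fun x => g k * x * g k) E0; rewrite mulr0 mul0r !mulrA gg // mul1r.
    by rewrite -mulrA gg // mulr1 => ->.
  have nQ : \poly_(i < size P) (g k * P`_i * g k) != 0 by rewrite -size_poly_eq0 sz size_poly_eq0.
  have := congr1 (fun p : {poly R} => odd (size p)) EP.
  rewrite (size_proper_mul (poly_in_lead_mul divB (conjP _ BP) nQ nP)) sz size_map_poly.
  rewrite size_mulX ?expf_neq0 // expr2 size_mul //.
  have : (0 < size P)%N by rewrite size_poly_gt0.
  have : (0 < size b)%N by rewrite size_poly_gt0.
  by case: (size P) => // p; case: (size b) => // q _ _; rewrite !addnS !addSn /= !oddD !addbb.
apply: (division_algebra_span (B := quad_ext B' (scaled c' k))); last first.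
  move=> f; rewrite /monomials /monomial big_ord_recr /= -/(monomial _ _ _) Em.
  apply: (subringM sQ).
    apply: quad_ext_base => //; apply: adjoin_base => //.
    exact: span_monomial.
  by case: ifP => _; [exact: quad_ext_gen|exact: (subring1 sQ)].
have memb m z : span io F' (@monomials R (scaled c') k.+1)
    (monomial (scaled c) k m * (if z then scaled c' k else 1)).
  have -> : monomial (scaled c) k m * (if z then scaled c' k else 1) =
      monomial (scaled c') k.+1 (fun i => if i == k then z else m i).
    rewrite -Em [RHS]/monomial big_ord_recr /= eqxx; congr (_ * _).
    by apply: eq_bigr => i _; rewrite ltn_eqF.
  exact: span_monomial.
split=> //.
- by move=> a Fa; apply: quad_ext_base => //; apply: FB'.
- move=> _ [y [z [/Bb'[e Fe ->] /Bb'[e' Fe' ->] ->]]].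
  apply: (spanD sF').
    apply: (span_sum sF') => f _; apply: (spanZ sF') => //.
    by rewrite -[monomials _ _]mulr1; apply: (memb _ false).
  rewrite mulr_suml; apply: (span_sum sF') => f _; rewrite -mulrA; apply: (spanZ sF') => //.
  exact: (memb _ true).
Qed.

Lemma ex_division_algebra (F0 : K -> Prop) k : (k <= N)%N ->
  subfield F0 -> enumerable F0 ->
  exists (F : K -> Prop) (c : nat -> K), [/\ subfield F /\ enumerable F,
    forall i, F (c i ^+ 2), forall i, (i < k)%N -> c i != 0 &
    division_algebra io (@monomials R (scaled c) k) F (span io F (@monomials R (scaled c) k))].
Proof.
move=> + sF0 eF0; elim: k => [_|k IH kN].
  have rF := subfield_subring sF0.
  exists F0, (fun=> 0); split=> // [i|]; first by rewrite expr0n; apply: subring0.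
  have m1 (f : {ffun 'I_0 -> bool}) : monomials (scaled (fun=> 0)) f = 1 :> R.
    by rewrite /monomials /monomial big_ord0.
  have sD : subring (span io F0 (@monomials R (scaled (fun=> 0)) 0)).
    by apply: (monomial_span_subring ioC (d := fun=> 0)).
  have FD : scalar_closed io F0 (span io F0 (@monomials R (scaled (fun=> 0)) 0)).
    exact: monomial_span_scalar.
  split=> // x [e Fe ->].
  under eq_bigr => f _ do rewrite m1 mulr1.
  rewrite -rmorph_sum => nx; set a := \sum_f e f in nx *.
  have Fa : F0 a by apply: (subring_sum rF).
  have na : a != 0 by apply: contraNneq nx => ->; rewrite rmorph0.
  by exists (io a^-1); [apply: FD; exact: subfieldV|rewrite ioVl].
have [F [c [[sF eF] Fc nc dA]]] := IH (ltnW kN).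
have [t Ht] := trK sF eF; have [s ss] := sqrtK t.
have nt := transcendental_neq0 sF Ht.
exists (adjoin_field F t), (fun i => if i == k then s else c i); split.
- by split; [exact: adjoin_subfield|exact: enumerable_adjoin].
- move=> i; case: ifP => _; last exact: adjoin_field_base.
  by rewrite expr2 ss; apply: adjoin_field_gen.
- move=> i; rewrite ltnS leq_eqVlt => /orP[/eqP->|lt].
    by rewrite eqxx; apply: contraNneq nt => s0; rewrite -ss s0 mul0r.
  by rewrite ltn_eqF // nc.
- exact: generic_division_algebra.
Qed.

End GenericAlgebra.

(** * Transcendental complex numbers *)

Section Uncountable.
Import classical_sets.

(** [R_uncountable] refutes bijections with the naturals, so the enumeration is first turned into
    one, using that the reals are infinite. *)
Lemma real_not_enumerable (e : nat -> Rdefinitions.R) :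
  ~ (forall x, exists n, e n = x).
Proof.
move=> He; have /choice[v Hv] := He.
have vinj : injective v by move=> x y /(congr1 e); rewrite !Hv.
have cR : cardinality.countable (@classical_sets.setT Rdefinitions.R).
  by apply/cardinality.countable_injP; exists v => x y _ _; apply: vinj.
have iR : ~ cardinality.finite_set (@classical_sets.setT Rdefinitions.R).
  pose f (n : nat) : Rdefinitions.R := n%:R.
  move=> finR; apply: cardinality.infinite_nat.
  apply: (@cardinality.finite_preimage _ _ _ f _ finR) => m n _ _ /eqP.
  by rewrite eqr_nat => /eqP.
have [f [_ finj fsurj]] :=
  elimT (@cardinality.card_set_bijP _ nat _ _) (cardinality.eq_card_nat cR iR).
have /choice[g Hg] : forall n, exists x, f x = n.
  by move=> n; have [x _ <-] := fsurj n I; exists x.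
apply: (@Runcountable.R_uncountable g); exists f; split=> [n|x]; first exact: Hg.
by apply: finj; rewrite ?inE // Hg.
Qed.

End Uncountable.

Section Complex.
Notation C := (Rdefinitions.R[i]).

(** Otherwise every real number would be named by the coefficient indices of a polynomial over [F]
    and the position of a root; real parts make this an enumeration of the reals. *)
Lemma ex_transcendental (F : C -> Prop) : enumerable F -> exists t, transcendental F t.
Proof.
move=> [e He]; apply: contrapT => H.
have alg t : exists p, [/\ poly_in F p, p != 0 & root p t].
  apply: contrapT => Ht; apply: H; exists t => p Fp p0; apply: contrapT => /eqP np.
  by apply: Ht; exists p; split=> //; apply/eqP.
pose h (n : seq nat * nat) : C :=
  (sval (closed_field_poly_normal (Poly [seq e k | k <- n.1])))`_n.2.
apply: (@real_not_enumerable (fun n => if unpickle n is Some c then complex.Re (h c) else 0)) => x.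
have [p [Fp np rp]] := alg (x%:C)%C.
have [s Es] := poly_in_enum He Fp.
pose z := sval (closed_field_poly_normal p).
have zx : (x%:C)%C \in z.
  move: rp; rewrite /z; case: (closed_field_poly_normal p) => r /= ->.
  by rewrite rootZ ?lead_coef_eq0 // root_prod_XsubC.
exists (pickle (s, index (x%:C)%C z)); rewrite pickleK /h /= -Es -/z nth_index //.
Qed.

End Complex.

(** * Diagonalization *)

Section Diagonalization.
Variables (F : fieldType) (V : vectType F) (q : V -> F).
Hypotheses (two : 2%:R != 0 :> F) (qq : quadratic_form q).

Lemma polarC u v : polar q u v = polar q v u.
Proof. by rewrite /polar [u + v]addrC addrAC. Qed.

Lemma polar_linear u a v w : polar q u (a *: v + w) = a * polar q u v + polar q u w.
Proof. by case: qq => _ _ H; apply: H. Qed.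

Lemma polar0 u : polar q u 0 = 0.
Proof.
have := polar_linear u 1 0 0; rewrite scale1r addr0 mul1r => /eqP.
by rewrite -subr_eq0 opprD addNKr oppr_eq0 => /eqP.
Qed.

Lemma polar_diag v : polar q v v = 2%:R * q v.
Proof.
case: qq => Z _ _; rewrite /polar -mulr2n -scaler_nat Z; ring.
Qed.

Lemma polar_sum u (e : seq V) (x : nat -> F) :
  polar q u (\sum_(i < size e) x i *: e`_i) = \sum_(i < size e) x i * polar q u e`_i.
Proof.
elim: e x => [|v e IH] x; first by rewrite !big_ord0 polar0.
by rewrite !big_ord_recl /= polar_linear (IH (fun i => x i.+1)).
Qed.

Definition orthogonal_family := pairwise (fun u v => polar q u v == 0).

Lemma orthogonal_value e (x : nat -> F) : orthogonal_family e ->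
  q (\sum_(i < size e) x i *: e`_i) = \sum_(i < size e) q e`_i * x i ^+ 2.
Proof.
case: (qq) => Z _ _; elim: e x => [|v e IH] x.
  by rewrite !big_ord0 -(scale0r 0) Z expr0n mul0r.
move=> /= /andP[/allP ve oe]; rewrite !big_ord_recl /=.
set w := \sum_(i < size e) _.
have -> : q (x 0%N *: v + w) = q (x 0%N *: v) + q w + polar q (x 0%N *: v) w.
  by rewrite /polar; ring.
rewrite Z -(IH (fun i => x i.+1) oe) (polar_sum _ _ (fun i => x i.+1)) big1 => [|i _].
  by rewrite addr0 mulrC.
rewrite polarC -[_ *: v]addr0 polar_linear polar0 addr0.
by rewrite polarC (eqP (ve _ (mem_nth _ _))) ?mulr0.
Qed.

(** Gram-Schmidt; anisotropy makes the denominators, equal to twice the values of [q], nonzero. *)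
Lemma orthogonal_basis : anisotropic q ->
  exists e : seq V, [/\ size e = \dim {:V}, basis_of {:V} e & orthogonal_family e].
Proof.
move=> an.
suff H k : (k <= \dim {:V})%N -> exists e : seq V, [/\ size e = k, free e & orthogonal_family e].
  have [e [se fe oe]] := H _ (leqnn _).
  by exists e; split=> //; rewrite basisEfree fe subvf se leqnn.
elim: k => [_|k IH km]; first by exists [::]; rewrite nil_free.
have [e [se fe oe]] := IH (ltnW km).
have [v nv] : exists v, v \notin <<e>>%VS.
  have := vlineP; move: km; rewrite -se -(eqP fe) => km _.
  have /subvPn[v _ nv] : ~~ ({:V} <= <<e>>)%VS.
    by apply: contraL km => /dimvS le; rewrite -leqNgt.
  by exists v.
pose x i := - (polar q v e`_i / polar q e`_i e`_i).
pose w := \sum_(i < size e) x i *: e`_i.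
have we : w \in <<e>>%VS.
  by apply: memv_suml => i _; apply: memvZ; apply: memv_span; apply: mem_nth.
exists ((v + w) :: e); split; rewrite /= ?se //.
  rewrite free_cons fe andbT; apply: contra nv => vw.
  by rewrite -[v](addrK w) memvB.
rewrite oe andbT; apply/(all_nthP 0) => j lt; apply/eqP.
rewrite polarC -[v]scale1r polar_linear mul1r polar_sum (bigD1 (Ordinal lt)) //=.
have nj : e`_j != 0.
  exact: free_not0 fe (mem_nth 0 lt).
have npj : polar q e`_j e`_j != 0.
  by rewrite polar_diag mulf_neq0 //; apply: contra_neq nj => /an.
rewrite big1 => [|i ij]; last first.
  suff -> : polar q e`_j e`_i = 0 by rewrite mulr0.
  have nij : (i : nat) != j by [].
  have /(pairwiseP 0) po := oe.
  move: nij; rewrite neq_ltn => /orP[l|l].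
    by rewrite polarC; apply/eqP; apply: po => //; rewrite inE.
  by apply/eqP; apply: po => //; rewrite inE.
by rewrite addr0 /x mulNr divfK // polarC subrr.
Qed.

End Diagonalization.

Section DiagonalForm.
Variables (F : fieldType) (m : nat) (a : 'I_m -> F).
Hypotheses (two : 2%:R != 0 :> F) (na : forall i, a i != 0).

Definition diagonal_form (v : 'rV[F]_m) : F := \sum_i a i * v 0 i ^+ 2.

Lemma polar_diagonal_form u v :
  polar diagonal_form u v = 2%:R * \sum_i a i * u 0 i * v 0 i.
Proof.
rewrite /polar /diagonal_form mulr_sumr -!sumrB; apply: eq_bigr => i _.
by rewrite !mxE; ring.
Qed.

Lemma diagonal_form_quadratic : quadratic_form diagonal_form.
Proof.
split=> [c v|v c u w|u c v w].
- rewrite /diagonal_form mulr_sumr; apply: eq_bigr => i _.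
  by rewrite mxE; ring.
- rewrite !polar_diagonal_form !mulr_sumr -big_split; apply: eq_bigr => i _.
  by rewrite !mxE /=; ring.
- rewrite !polar_diagonal_form !mulr_sumr -big_split; apply: eq_bigr => i _.
  by rewrite !mxE /=; ring.
Qed.

Lemma diagonal_form_nondegenerate : quad_nondegenerate diagonal_form.
Proof.
move=> u Hu; apply/rowP => i; have := Hu (delta_mx 0 i).
rewrite polar_diagonal_form (bigD1 i) //= big1 => [|j ji]; last first.
  by rewrite mxE (negbTE ji) andbF mulr0.
rewrite !mxE !eqxx mulr1 addr0 => /eqP.
by rewrite !mulf_eq0 (negbTE two) (negbTE (na i)) => /eqP.
Qed.

End DiagonalForm.

(** * The m-invariant of a subfield *)

Section SubfieldForms.
Variables (K : fieldType) (F : K -> Prop) (sF : subfield F).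
Hypothesis two : 2%:R != 0 :> K.
Let FT : fieldType := subfield_type sF.

Lemma subfield_val_in (x : FT) : F (val x).
Proof. exact/asboolP/(subfield_valP x). Qed.

Lemma ex_subfield_val a : F a -> exists x : FT, val x = a.
Proof.
by move=> Fa; have H : a \in subfield_mem sF by [apply/asboolP]; exists (SubfieldElt H).
Qed.

Lemma subfield_two : 2%:R != 0 :> FT.
Proof.
apply: contra_neq two => E; have := congr1 (\val : {rmorphism FT -> K}) E.
by rewrite rmorph_nat rmorph0.
Qed.

Lemma val_form_value m (a x : 'I_m -> FT) (rho : seq K) (y : nat -> K) :
  size rho = m -> (forall i : 'I_m, rho`_i = val (a i)) -> (forall i : 'I_m, y i = val (x i)) ->
  form_value rho y = val (\sum_i a i * x i ^+ 2).
Proof.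
move=> sr; case: m / sr in a x * => Ea Ex; rewrite (rmorph_sum (\val : {rmorphism FT -> K})).
by apply: eq_bigr => i _; rewrite Ea Ex rmorphM rmorphXn.
Qed.

Lemma val_isotropic m (a : 'I_m -> FT) (rho : seq K) :
  size rho = m -> (forall i : 'I_m, rho`_i = val (a i)) ->
  isotropic F rho <->
  exists2 x : 'I_m -> FT, exists i, x i != 0 & \sum_i a i * x i ^+ 2 = 0.
Proof.
move=> sr Ea; split=> [[y [Fy [i lt ny] E]]|[x [i nx] E]].
  have /choice[z Hz] : forall i, exists x : FT, val x = y i.
    by move=> j; apply: ex_subfield_val.
  rewrite sr in lt; exists (fun j : 'I_m => z j).
    exists (Ordinal lt); apply: contraNneq ny => z0.
    by rewrite -(Hz i) (z0 : z i = 0).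
  by apply/val_inj; rewrite -(val_form_value sr Ea (y := y)).
pose y k := if insub k is Some j then val (x j) else 0.
have Ey (j : 'I_m) : y j = val (x j) by rewrite /y valK.
exists y; split.
- move=> k; rewrite /y; case: insub => [j|]; first exact: subfield_val_in.
  by apply: subring0; apply: subfield_subring.
- by exists i; rewrite ?sr // Ey; apply: contra_neq nx => x0; apply/val_inj.
- by rewrite (val_form_value sr Ea Ey) E.
Qed.

(** The hypothesis is used twice: on [- c :: q], to see that [q] represents [c], and on a
    diagonalisation of a smaller anisotropic form, to find a value that it misses. *)
Lemma m_invariant_subfield (q : seq K) :
  coefs_in F q -> nonzero_coefs q -> ~ isotropic F q ->
  (forall rho, coefs_in F rho -> nonzero_coefs rho -> size rho != size q ->
     isotropic F rho \/ exists w, [/\ F w, w != 0, ~ isotropic F (- w :: rho) &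
       forall a, rho <> a :: q]) ->
  m_invariant_eq FT (size q).
Proof.
move=> Fq nq aq H; have rF := subfield_subring sF.
split.
  have /choice[a Ha] : forall i : 'I_(size q), exists x : FT, val x = q`_i.
    by move=> i; apply: ex_subfield_val.
  have na i : a i != 0.
    by apply: contraTneq (nq i (ltn_ord i)) => a0; rewrite -Ha a0 eqxx.
  have Ea (i : 'I_(size q)) : q`_i = val (a i) by rewrite Ha.
  have an : anisotropic (diagonal_form a).
    move=> v qv; apply/rowP => i; rewrite mxE; apply/eqP; apply: contrapT => /negP nv.
    apply: aq; apply/(val_isotropic (erefl _) Ea).
    by exists (fun j => v 0 j) => //; exists i.
  exists 'rV[FT]_(size q), (diagonal_form a).
  split; last by rewrite dimvf /dim /= mul1n.
  split=> //; first exact: diagonal_form_quadratic.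
    exact: (diagonal_form_nondegenerate subfield_two na).
  move=> c nc.
  have Fc := subfield_val_in c.
  (* The second alternative is closed by its last clause, since the form is [- val c] followed by
     [q]. *)
  have [|||iso|[w [_ _ _ /(_ (- val c))]]//] := H (- val c :: q).
  - by case=> [|i] /=; [apply: subringN|].
  - case=> [_|i] /=; last exact: nq.
    by rewrite oppr_eq0; apply: contra_neq nc => c0; apply/val_inj.
  - by rewrite /= -{2}[size q]addn0 -addn1 eqn_add2l.
  have [x [Fx x0 Ex]] : exists x,
      [/\ forall i, F (x i), x 0%N != 0 & form_value (- val c :: q) x = 0].
    case: iso => x [Fx [i lt nx] E]; exists x; split=> //.
    apply: contra_notN aq => /eqP x0; exists (fun i => x i.+1); split=> //.
      by case: i lt nx => [|i] lt; [rewrite x0 eqxx|exists i].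
    by move: E; rewrite form_value_cons x0 expr0n mulr0 add0r.
  have /choice[z Hz] : forall i, exists y : FT, val y = x i.+1 / x 0%N.
    by move=> i; apply: ex_subfield_val; apply: (subringM rF) => //; apply: subfieldV.
  exists (\row_i z i); apply/val_inj; rewrite /diagonal_form.
  under eq_bigr => i _ do rewrite mxE.
  rewrite -(val_form_value (erefl _) Ea (y := fun i => x i.+1 / x 0%N)) => [|i]; last by rewrite Hz.
  apply: (mulIf (x := x 0%N ^+ 2)); first by rewrite expf_neq0.
  move/eqP: Ex; rewrite form_value_cons mulNr addrC subr_eq0 => /eqP <-.
  rewrite /form_value mulr_suml; apply: eq_bigr => i _; field.
  exact: x0.
move=> V p [qp _ ap up]; rewrite leqNgt; apply/negP => lt.
have [e [se /andP[/eqP span_e free_e] oe]] := orthogonal_basis subfield_two qp ap.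
pose rho := [seq val (p v) | v <- e].
have sr : size rho = size e by rewrite size_map.
have Ea (i : 'I_(size e)) : rho`_i = val (p e`_i) by rewrite (nth_map 0).
have Frho : coefs_in F rho.
  move=> i; have [l|g] := ltnP i (size e); last by rewrite nth_default ?sr //; apply: subring0.
  by rewrite (nth_map 0) //; apply: subfield_val_in.
have value (x : 'I_(size e) -> FT) :
    p (\sum_(i < size e) x i *: e`_i) = \sum_(i < size e) p e`_i * x i ^+ 2.
  pose y (k : nat) : FT := if insub k is Some j then x j else 0.
  have Ey (j : 'I_(size e)) : y j = x j by rewrite /y valK.
  under eq_bigr => i _ do rewrite -Ey.
  by rewrite (orthogonal_value qp y oe); apply: eq_bigr => i _; rewrite Ey.
have nrho : nonzero_coefs rho.
  move=> i; rewrite sr => l; rewrite (nth_map 0) //.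
  have := free_not0 free_e (mem_nth 0 l); apply: contra_neq => E.
  by apply: ap; apply/val_inj.
have [||||[w [Fw nw aniso _]]] := H rho _ _ _ => //.
- by rewrite sr se neq_ltn lt.
- move=> /(val_isotropic sr Ea)[x [i nx] E].
  have := ap _ (etrans (value x) E).
  have /(@freeP _ _ _ (in_tuple e)) fe := free_e.
  by move=> /(fe x)/(_ i) x0; rewrite x0 eqxx in nx.
have [w' Ew] := ex_subfield_val Fw.
have [|v Ev] := up w'; first by apply: contraNneq nw => w0; rewrite -Ew w0.
have := memvf v; rewrite -span_e => /(coord_span (X := in_tuple e)) Ec.
apply: aniso; pose x i := coord (in_tuple e) i v.
(* If [p] took the value [w] at [v], then 1 followed by the coordinates of [v] would be a zero of
   [- w :: rho]. *)
pose y k := if k is k'.+1 then (if insub k' is Some j then val (x (j : 'I_(size e))) else 0) else 1.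
exists y; split.
- case=> [|k] /=; first exact: subring1.
  by case: insub => [j|]; [exact: subfield_val_in|exact: subring0].
- by exists 0%N => //=; rewrite oner_neq0.
- rewrite form_value_cons (val_form_value sr Ea (x := x)) => [|i]; last by rewrite /y valK.
  by rewrite -value -Ec Ev Ew expr1n mulr1 addNr.
Qed.

End SubfieldForms.

Theorem theorem4p1 (n : nat) (hn : (1 <= n)%N) :
  exists F : fieldType, 2%N \notin [pchar F] /\ m_invariant_eq F (2 * n)%N.
Proof.
pose C : numClosedFieldType := Rdefinitions.R[i]%C.
have two : 2%:R != 0 :> C by rewrite pnatr_eq0.
have sqrtK (a : C) : exists s, s * s = a by exists (sqrtC a); rewrite -expr2 sqrtCK.
have trK (F : C -> Prop) : subfield F -> enumerable F -> exists t, transcendental F t.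
  by move=> _; apply: ex_transcendental.
have [R [io [g [ioC ag gg]]]] := ex_anticommuting_involutions n (sqrtK (-1)).
(* The form has dimension [r + 1 = 2n]. The matrix ring supplies one generator more than [D] uses,
   as independence of monomials starts from an even number. *)
pose r := n.*2.-1; have rE : r.+1 = n.*2 by rewrite /r prednK // double_gt0.
have oddr : odd r by have := odd_double n; rewrite -rE /= => /negbFE.
have rN : (r <= n.*2)%N by rewrite -rE.
pose Q (x : C) := exists a : rat, x = ratr a.
have sQ : subfield Q.
  split=> [|_ _ [a ->] [b ->]|_ _ [a ->] [b ->]|_ [a ->]].
  - by exists 1; rewrite rmorph1.
  - by exists (a - b); rewrite rmorphB.
  - by exists (a * b); rewrite rmorphM.
  - by exists a^-1; rewrite fmorphV.
have eQ : enumerable Q.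
  by apply: (@enumerable_countType _ rat ratr) => x [a ->]; exists a.
have [|F [c [[sF eF] Fc nc dD]]] := ex_division_algebra ioC two sqrtK trK ag gg _ rN sQ eQ.
  by rewrite odd_double.
pose d i := c i ^+ 2; pose u := scaled io g c.
have au : anticommuting u r.
  move=> i j lti ltj; apply: (scaled_anticommuting ioC ag); exact: leq_trans rN.
have du i : (i < r)%N -> u i * u i = io (d i).
  by move=> lt; apply: (scaled_sqr ioC gg); apply: leq_trans rN.
have iu : independent io (@monomials R u r).
  by apply: (scaled_independent ioC two ag gg) => //; rewrite odd_double.
have nd i : (i < r)%N -> d i != 0 by move=> lt; rewrite expf_neq0 ?nc.
have r0 : (0 < r)%N by case: (r) oddr.
have rF := subfield_subring sF.
have sM : subfield (quad_ext F (c 0%N)) by apply: quad_ext_subfield => //; rewrite -expr2.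
(* A first [M]: once [c 0], a square root of [d 0], is adjoined, the form has the zero
   [(c 0, 1, 0, ...)]. *)
have st : stage io u d r F (quad_ext F (c 0%N)).
  split=> //; first by move=> a; apply: quad_ext_base.
    exact: enumerable_quad_ext.
  split=> //; exists (fun i => if i == 0%N then c 0%N else (i == 1%N)%:R); split.
  - move=> i; case: ifP => _; first exact: quad_ext_gen.
    apply: quad_ext_base => //; case: eqP => _; [exact: subring1|exact: subring0].
  - by exists 0%N; rewrite //= nc.
  - rewrite form_value_clifford /= (bigD1 (Ordinal r0)) //= expr1n mulr1 big1 ?addr0 ?subrr //.
    by move=> [[|i] lt] //= _; rewrite expr0n mulr0.
have [L [sL Ld aniso HL]] := stage_limit ioC two sqrtK trK au du iu nd oddr st.
exists (subfield_type sL); split.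
  by apply/negP; rewrite inE => /andP[_]; apply/negP; apply: (subfield_two sL two).
have sq : size (clifford_form d r) = r.+1 by rewrite /= size_mkseq.
have -> : (2 * n)%N = size (clifford_form d r) by rewrite sq rE mul2n.
apply: m_invariant_subfield => //.
- have rL := subfield_subring sL.
  case=> [|i] /=; first exact: subring1.
  have [lt|ge] := ltnP i r; last by rewrite nth_default ?size_mkseq //; apply: subring0.
  by rewrite nth_mkseq //; apply: subringN.
- case=> [_|i] /=; first exact: oner_neq0.
  by rewrite ltnS size_mkseq => lt; rewrite nth_mkseq // oppr_eq0 nd.
- by rewrite sq.
Qed.
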